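(* Consider the resonant system $$\begin{aligned} \dot a_k&=(\lambda_m-\lambda_n)\Gamma a_ma_n,\\ \dot a_m&=(\lambda_n-\lambda_k)\Gamma a_na_k,\\ \dot a_n&=(\lambda_k-\lambda_m)\Gamma a_ka_m+(\lambda_{\tilde k}-\lambda_{\tilde m})\tilde\Gamma a_{\tilde k}a_{\tilde m},\\ \dot a_{\tilde m}&=(\lambda_n-\lambda_{\tilde k})\tilde\Gamma a_na_{\tilde k},\\ \dot a_{\tilde k}&=(\lambda_{\tilde m}-\lambda_n)\tilde\Gamma a_{\tilde m}a_n . \end{aligned}$$ Under the conditions $$\lambda_m<\lambda_k<\lambda_n,\qquad \lambda_{\tilde m}<\lambda_n<\lambda_{\tilde k},$$ which imply $\alpha<0$, $\tilde\alpha<0$, the equilibria $(\pm a_k(0),0,0,0,\pm a_{\tilde k}(0))$ are hyperbolic for $|a_{\tilde k}(0)|$ small enough with respect to $|a_k(0)|$. The unstable manifolds of these equilibria are one dimensional, and the nonlinear dynamics of the system are constrained on the ellipse $\mathcal{E}_1=a_k^2+(1-\alpha)a_m^2$ for $a_k(t),a_m(t)$, the hyperbola $\mathcal{E}_3=a_{\tilde k}^2+\tilde\alpha a_{\tilde m}^2$ for $a_{\tilde k}(t),a_{\tilde m}(t)$, and the hyperboloid $\mathcal{E}_2=a_n^2+\alpha a_m^2+(1-\tilde\alpha)a_{\tilde m}^2$ for $a_m(t),a_{\tilde m}(t),a_n(t)$.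
   Context: The system couples two $SO(3;\mathbf{R})$ rigid bodies through the common component $a_n(t)$. It arises from the resonant 3D Euler equations for two resonant wave number triplets $(k,m,n)$ and $(\tilde k,\tilde m,n)$ sharing $n$, with $n=k+m=\tilde k+\tilde m$. The unknowns are ordered as $(a_k,a_m,a_n,a_{\tilde m},a_{\tilde k})$. The real numbers $\lambda_j$, $j\in\{k,m,n,\tilde k,\tilde m\}$, are eigenvalues of the curl operator with eigenfunctions $\mathbf{\Phi}_j$, i.e. $\mathrm{curl}\,\mathbf{\Phi}_j=\lambda_j\mathbf{\Phi}_j$. The parameters $\Gamma=i\langle\mathbf{\Phi}_k\times\mathbf{\Phi}_m,\mathbf{\Phi}_n^*\rangle$ and $\tilde\Gamma=i\langle\mathbf{\Phi}_{\tilde k}\times\mathbf{\Phi}_{\tilde m},\mathbf{\Phi}_n^*\rangle$ are in $\mathbf{R}$, where $\langle\cdot,\cdot\rangle$ is the complex-valued $L^2$ inner product on the flow domain and $^*$ denotes complex conjugation. Notation: $\alpha=(\lambda_m-\lambda_k)/(\lambda_n-\lambda_k)$ and $\tilde\alpha=(\lambda_{\tilde m}-\lambda_n)/(\lambda_{\tilde k}-\lambda_n)$. The quantities $\mathcal{E}_1$, $\mathcal{E}_2$, $\mathcal{E}_3$ given by the formulas in the claim are three independent conservation laws of the system.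
   Formalization: ''Hyperbolic'' is read as hyperbolic transversally to the 3-dimensional manifold of equilibria (0 is always a triple eigenvalue); Γ≠0 is assumed for hyperbolicity and unstable manifolds; the ellipse, hyperbola and hyperboloid shapes are claimed only for nonzero values of E1, E3, E2. *)

(* Defs.v *)
From HB Require Import structures.
From mathcomp Require Import all_boot all_order all_algebra.
From mathcomp Require Import all_classical all_reals all_analysis.
From mathcomp Require Import complex.
Import Order.TTheory GRing.Theory Num.Theory.
Import numFieldNormedType.Exports.

Set Implicit Arguments.
Unset Strict Implicit.
Unset Printing Implicit Defensive.

Local Open Scope classical_set_scope.
Local Open Scope ring_scope.

Section DynamicalSystems.
Context {R : realType} {n : nat}.
Implicit Types (f : 'rV[R]_n -> 'rV[R]_n) (p : 'rV[R]_n).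

Definition is_solution f (I : set R) (a : R -> 'rV[R]_n) : Prop :=
  forall t, I t -> is_derive t 1 a (f (a t)).

(* A C^1 immersed d-dimensional patch consisting of equilibria of f. *)
Definition equilibrium_patch f d p : Prop :=
  exists phi : 'rV[R]_d -> 'rV[R]_n,
    [/\ phi 0 = p,
        \forall u \near (0 : 'rV[R]_d),
          differentiable phi u /\ {for u, continuous (jacobian phi)},
        row_free (jacobian phi 0)
      & \forall u \near (0 : 'rV[R]_d), f (phi u) = 0].

(* Hyperbolicity transversally to a d-dimensional manifold of equilibria
   (normal hyperbolicity): the linearization has no nonzero purely imaginary
   eigenvalue, and 0 is an eigenvalue of algebraic multiplicity exactly d, so
   that the d zero eigenvalues are those forced by the directions tangent to
   the manifold of equilibria and the other n - d eigenvalues lie off the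
   imaginary axis.  For d = 0 this is the usual hyperbolicity of an
   equilibrium. *)
Definition hyperbolic_equilibrium f d p : Prop :=
  [/\ f p = 0,
      differentiable f p,
      equilibrium_patch f d p,
      (forall z : R[i],
         eigenvalue (map_mx (real_complex R) (jacobian f p)) z ->
         complex.Re z = 0 -> z = 0)
    & mup 0 (char_poly (jacobian f p)) = d].

Definition unstable_manifold f p : set 'rV[R]_n :=
  [set x | exists (a : R -> 'rV[R]_n) (T : R),
     [/\ 0 < T, is_solution f [set t | t < T] a, a 0 = x
       & a t @[t --> -oo] --> p]].

(* One dimensional manifold, as an injectively immersed C^1 line: globally an
   unstable manifold is in general only immersed, since its two branches may
   come back to the equilibrium along homoclinic orbits. *)
Definition immersed_line (W : set 'rV[R]_n) : Prop :=
  exists g : R -> 'rV[R]_n,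
    [/\ forall s, derivable g s 1,
        continuous (derive1 g),
        forall s, derive1 g s != 0,
        injective g
      & range g = W].

End DynamicalSystems.

Section Conics.
Context {R : realType}.

Definition is_ellipse (C : set (R * R)) : Prop :=
  exists p q : R, [/\ 0 < p, 0 < q
    & C = [set z | z.1 ^+ 2 / p ^+ 2 + z.2 ^+ 2 / q ^+ 2 = 1]].

Definition is_hyperbola (C : set (R * R)) : Prop :=
  exists p q e : R, [/\ 0 < p, 0 < q, e = 1 \/ e = -1
    & C = [set z | z.1 ^+ 2 / p ^+ 2 - z.2 ^+ 2 / q ^+ 2 = e]].

(* One sheet for e = 1, two sheets for e = -1; the axis is the first
   coordinate. *)
Definition is_hyperboloid (C : set (R * R * R)) : Prop :=
  exists p q r e : R, [/\ 0 < p, 0 < q, 0 < r, e = 1 \/ e = -1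
    & C = [set z | z.1.2 ^+ 2 / q ^+ 2 + z.2 ^+ 2 / r ^+ 2
                     - z.1.1 ^+ 2 / p ^+ 2 = e]].

End Conics.

(* State vectors are (a_k, a_m, a_n, a_mt, a_kt), where the suffix t stands
   for a tilde. *)
Definition i_k : 'I_5 := @Ordinal 5 0 isT.
Definition i_m : 'I_5 := @Ordinal 5 1 isT.
Definition i_n : 'I_5 := @Ordinal 5 2 isT.
Definition i_mt : 'I_5 := @Ordinal 5 3 isT.
Definition i_kt : 'I_5 := @Ordinal 5 4 isT.

Section ResonantSystem.
Context {R : realType}.

Definition state (ak am an amt akt : R) : 'rV[R]_5 :=
  \row_i [:: ak; am; an; amt; akt]`_i.

Definition resonant_field (lk lm ln lmt lkt G Gt : R) (x : 'rV[R]_5) :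
    'rV[R]_5 :=
  let ak := x 0 i_k in let am := x 0 i_m in let an := x 0 i_n in
  let amt := x 0 i_mt in let akt := x 0 i_kt in
  state ((lm - ln) * G * am * an)
        ((ln - lk) * G * an * ak)
        ((lk - lm) * G * ak * am + (lkt - lmt) * Gt * akt * amt)
        ((ln - lkt) * Gt * an * akt)
        ((lmt - ln) * Gt * amt * an).

Definition alpha (lk lm ln : R) : R := (lm - lk) / (ln - lk).
Definition alphat (ln lmt lkt : R) : R := (lmt - ln) / (lkt - ln).

(* Level sets, in the coordinates (a_k, a_m), (a_m, a_mt, a_n) and
   (a_kt, a_mt) respectively. *)
Definition level1 (al e1 : R) : set (R * R) :=
  [set z | e1 = z.1 ^+ 2 + (1 - al) * z.2 ^+ 2].
Definition level2 (al alt e2 : R) : set (R * R * R) :=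
  [set z | e2 = z.2 ^+ 2 + al * z.1.1 ^+ 2 + (1 - alt) * z.1.2 ^+ 2].
Definition level3 (alt e3 : R) : set (R * R) :=
  [set z | e3 = z.1 ^+ 2 + alt * z.2 ^+ 2].

End ResonantSystem.

(* Main.v *)
Require Import Defs.
From mathcomp Require Import all_boot all_order all_algebra.
From mathcomp Require Import all_classical all_reals all_analysis.
From mathcomp Require Import ring lra complex.
Import Order.TTheory GRing.Theory Num.Theory.
Import numFieldNormedType.Exports.
Local Open Scope classical_set_scope.
Local Open Scope ring_scope.

(* Put [w ^ 2 = - c1 c2], [c1 = (lm - ln) G], [c2 = (ln - lk) G].  In the time variable
   [x] with [x' = w a_n], the pair (a_k, a_m) rotates and the pair (a_kt, a_mt) undergoes
   a hyperbolic rotation, so on the set where a solution tends to (k0, 0, 0, 0, l0) in the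
   past all five coordinates are functions of [x] and [y = x'], and [x] solves the
   one-degree-of-freedom equation [x'' = P sin x cos x - Q r sinh (r x) cosh (r x)] with
   energy [y ^ 2 = P sin ^ 2 x - Q sinh ^ 2 (r x)].  The origin is a saddle of that equation
   exactly when [Q r ^ 2 < P], that is, when |l0| is small with respect to |k0|.  If
   [Q r = 0] its unstable manifold consists of the two pendulum separatrices [x = 2 atan s];
   otherwise it is a figure eight, the union of two homoclinic loops with turning points
   [+- a], parametrized by [x = 2 a s / (1 + s ^ 2)].  In both cases time acts by
   [s' = s v(s)] with [v] continuous, positive and bounded.
   The linearization has characteristic polynomial
   [X ^ 3 (X ^ 2 - (k0 ^ 2 c2 c3 + l0 ^ 2 c4 c6))]. *)

(** The immersed-line claim is global and concerns a set defined by past limits, so this set has to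
    be identified exactly: every solution tending to the equilibrium must lie on one explicit curve,
    and every point of the curve must lie on such a solution. The first inclusion evaluates
    conserved quantities at [-oo]; the second needs the flow on the curve for all times, which a
    rescaled dilation of bounded speed provides. A loop cannot be parametrized by [x], because [y]
    behaves like a square root at the turning points; with [x = 2 a s / (1 + s ^ 2)] the factor
    [a ^ 2 - x ^ 2] becomes a square and [y] changes sign differentiably at [s = 1] and [s = -1].
    Both ends of the line return to the saddle without reaching it, so the figure eight is still an
    injective image. As [v] is only known to be continuous, the derivative of [y] comes from
    first-order quotients with continuous factors. The factor [X ^ 3] is unavoidable: the equilibria
    with [a_n = 0] form a cone of dimension 3, and hyperbolicity is meant transversally to it. *)

Set Implicit Arguments.
Unset Strict Implicit.
Unset Printing Implicit Defensive.

(** * Derivatives and antiderivatives *)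

Section Calculus.
Context {R : realType}.
Implicit Types (f g h : R -> R) (x a b : R).

(** Lets [derive_fun] synthesize the derivative as an evar; the expected value is matched afterwards
    by [ring] or [field]. *)
Lemma is_derive_ex f x a : (exists b, is_derive x 1 f b /\ b = a) -> is_derive x 1 f a.
Proof. by move=> [b [fb <-]]. Qed.
Lemma continuous_fun_cst (k : R) x : {for x, continuous (fun _ : R => k)}.
Proof. exact: cvg_cst. Qed.
Lemma continuous_fun_id x : {for x, continuous (fun t : R => t)}.
Proof. exact: cvg_id. Qed.
Lemma continuous_fun_add f g x : {for x, continuous f} -> {for x, continuous g} ->
  {for x, continuous (fun t => f t + g t)}.
Proof. exact: cvgD. Qed.
Lemma continuous_fun_opp f x : {for x, continuous f} -> {for x, continuous (fun t => - f t)}.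
Proof. exact: cvgN. Qed.
Lemma continuous_fun_mul f g x : {for x, continuous f} -> {for x, continuous g} ->
  {for x, continuous (fun t => f t * g t)}.
Proof. exact: cvgM. Qed.
Lemma continuous_fun_exp n f x : {for x, continuous f} -> {for x, continuous (fun t => f t ^+ n)}.
Proof. by move=> cf; apply: (cvg_comp f (fun y => y ^+ n) cf); exact: exprn_continuous. Qed.
Lemma continuous_fun_inv f x : f x != 0 -> {for x, continuous f} ->
  {for x, continuous (fun t => (f t)^-1)}.
Proof. by move=> f0 cf; apply: cvgV. Qed.
Lemma continuous_fun_comp f g x : {for f x, continuous g} -> {for x, continuous f} ->
  {for x, continuous (fun t => g (f t))}.
Proof. by move=> cg cf; exact: (cvg_comp f g cf cg). Qed.
Lemma continuous_fun_max f g x : {for x, continuous f} -> {for x, continuous g} ->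
  {for x, continuous (fun t => Num.max (f t) (g t))}.
Proof. exact: continuous_max. Qed.

Lemma is_derive_fun_cst (k : R) x : is_derive x 1 (fun=> k) 0.
Proof. exact: is_derive_cst. Qed.
Lemma is_derive_fun_id x : is_derive x 1 (fun t : R => t) 1.
Proof. exact: is_derive_id. Qed.
Lemma is_derive_fun_add f g x a b : is_derive x 1 f a -> is_derive x 1 g b ->
  is_derive x 1 (fun t => f t + g t) (a + b).
Proof. by move=> ? ?; exact: is_deriveD. Qed.
Lemma is_derive_fun_opp f x a : is_derive x 1 f a -> is_derive x 1 (fun t => - f t) (- a).
Proof. by move=> ?; exact: is_deriveN. Qed.
Lemma is_derive_fun_mul f g x a b : is_derive x 1 f a -> is_derive x 1 g b ->
  is_derive x 1 (fun t => f t * g t) (a * g x + f x * b).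
Proof.
move=> fa gb; apply: is_derive_eq.
by rewrite addrC /GRing.scale /= (mulrC a).
Qed.
Lemma is_derive_fun_exp n f x a : is_derive x 1 f a ->
  is_derive x 1 (fun t => f t ^+ n.+1) (n.+1%:R * f x ^+ n * a).
Proof.
move=> fa; elim: n => [|n IH].
  by rewrite expr0 !mul1r.
rewrite (_ : (fun t => _) = fun t => f t * f t ^+ n.+1); last first.
  by apply/funext => t; rewrite exprS.
apply: (is_derive_eq (is_derive_fun_mul fa IH)).
by rewrite -[in RHS]natr1 exprS; ring.
Qed.
Lemma is_derive_fun_inv f x a : f x != 0 -> is_derive x 1 f a ->
  is_derive x 1 (fun t => (f t)^-1) (- a / f x ^+ 2).
Proof.
move=> f0 fa; apply: (is_derive_eq (is_deriveV f0 fa)).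
by rewrite /GRing.scale /= mulrC mulrN mulNr.
Qed.
Lemma is_derive_fun_comp f g x a b : is_derive (g x) 1 f a -> is_derive x 1 g b ->
  is_derive x 1 (fun t => f (g t)) (a * b).
Proof. by move=> ? ?; exact: is_derive1_comp. Qed.

Lemma is_derive_fun_expR f x a : is_derive x 1 f a ->
  is_derive x 1 (fun t => expR (f t)) (expR (f x) * a).
Proof. exact: is_derive_fun_comp. Qed.
End Calculus.

(** Atoms are closed by hypotheses of the context, whence the habit of naming the derivatives of
    [sin], [cosh] or an unknown function just before a call. The power rule is stated for
    successors, so the exponent is passed as [n.-1]. *)
Ltac derive_fun := lazymatch goal with
  | |- is_derive _ _ (fun t => @?f t + @?g t) _ =>
    notypeclasses refine (@is_derive_fun_add _ f g _ _ _ _ _); derive_fun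
  | |- is_derive _ _ (fun t => - @?f t) _ => notypeclasses refine (@is_derive_fun_opp _ f _ _
    _); derive_fun
  | |- is_derive _ _ (fun t => @?f t * @?g t) _ =>
    notypeclasses refine (@is_derive_fun_mul _ f g _ _ _ _ _); derive_fun
  | |- is_derive _ _ (fun t => @?f t ^+ ?n) _ =>
    notypeclasses refine (@is_derive_fun_exp _ n.-1 f _ _ _); derive_fun
  | |- is_derive _ _ (fun t => expR (@?f t)) _ =>
    notypeclasses refine (@is_derive_fun_expR _ f _ _ _); derive_fun
  | |- is_derive _ _ (fun t => t) _ => notypeclasses refine (is_derive_fun_id _)
  | |- _ => first [ eassumption | notypeclasses refine (is_derive_fun_cst _ _) | idtac ]
  end.

Ltac continuity_fun := lazymatch goal with
  | |- prop_for _ (inPhantom (forall t, continuous_at t (fun x => @?f x + @?g x))) =>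
    apply: (@continuous_fun_add _ f g); continuity_fun
  | |- prop_for _ (inPhantom (forall t, continuous_at t (fun x => - @?f x))) =>
    apply: (@continuous_fun_opp _ f); continuity_fun
  | |- prop_for _ (inPhantom (forall t, continuous_at t (fun x => @?f x * @?g x))) =>
    apply: (@continuous_fun_mul _ f g); continuity_fun
  | |- prop_for _ (inPhantom (forall t, continuous_at t (fun x => @?f x ^+ ?n))) =>
    apply: (@continuous_fun_exp _ n f); continuity_fun
  | |- prop_for _ (inPhantom (forall t, continuous_at t (fun x => Num.max (@?f x) (@?g x)))) =>
    apply: (@continuous_fun_max _ f g); continuity_fun
  | |- prop_for _ (inPhantom (forall t, continuous_at t (fun x => x))) => exact: continuous_fun_id
  | |- _ => first [ assumption | exact: continuous_fun_cst | idtac ]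
  end.

Section Calculus2.
Context {R : realType}.
Implicit Types (f g h : R -> R) (x a b : R).

Definition cosh (x : R) := (expR x + expR (- x)) / 2.
Definition sinh (x : R) := (expR x - expR (- x)) / 2.

Lemma is_derive_fun_cosh f x a : is_derive x 1 f a ->
  is_derive x 1 (fun t => cosh (f t)) (sinh (f x) * a).
Proof.
move=> fa; apply: is_derive_ex; eexists; split; first by rewrite ?/cosh ?/sinh; derive_fun.
by rewrite /sinh; ring.
Qed.
Lemma is_derive_fun_sinh f x a : is_derive x 1 f a ->
  is_derive x 1 (fun t => sinh (f t)) (cosh (f x) * a).
Proof.
move=> fa; apply: is_derive_ex; eexists; split; first by rewrite ?/cosh ?/sinh; derive_fun.
by rewrite /cosh; ring.
Qed.
Lemma is_derive_fun_cos f x a : is_derive x 1 f a ->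
  is_derive x 1 (fun t => cos (f t)) (- sin (f x) * a).
Proof. exact: is_derive_fun_comp. Qed.
Lemma is_derive_fun_sin f x a : is_derive x 1 f a ->
  is_derive x 1 (fun t => sin (f t)) (cos (f x) * a).
Proof. exact: is_derive_fun_comp. Qed.
Lemma is_derive_continuous f x a : is_derive x 1 f a -> {for x, continuous f}.
Proof.
by case=> df _; apply/differentiable_continuous/derivable1_diffP.
Qed.

(** An integral from a fixed base point is an antiderivative only to the right of that point. So [h]
    is split at [0] into a constant and two continuous parts, each vanishing on a half-line; the
    part on the negative axis is treated by reflection. *)
Lemma antiderivative h : continuous h -> exists H : R -> R, forall t : R, is_derive t 1 H (h t).
Proof.
move=> hcont.
have half (k : R -> R) : continuous k -> (forall t, t <= 0 -> k t = 0) ->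
    exists H : R -> R, forall t : R, is_derive t 1 H (k t).
  move=> ck k0.
  (* The base point [-1] lies strictly left of where [k] can be nonzero: [H] is locally zero around
     points up to [- 2^-1], and the fundamental theorem applies beyond. *)
  pose H x : R := (\int[lebesgue_measure]_(t in [set` `[-1, x]]) (k t))%R.
  exists H => t.
  have [tN|t0] := leP t (- 2^-1).
    rewrite k0; last by lra.
    have : \forall x \near t, (fun=> 0 : R) x = H x.
      near=> x.
      have x0 : x < 0 by near: x; apply: lt_nbhsl; lra.
      rewrite /H; under eq_Rintegral => y yx.
        rewrite k0; last first.
          by move: yx; rewrite inE /= in_itv /= => /andP[_ /le_trans]; apply; exact: ltW.
        over.
      by rewrite Rintegral_cst ?mul0r//; exact: measurable_itv.
    by move=> Hn; apply: (near_eq_is_derive Hn (is_derive_fun_cst 0 t)).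
  have tu : t < t + 1 by lra.
  have [] := @continuous_FTC1_closed _ k (-1) t (t + 1) tu.
  - apply: continuous_compact_integrable; first exact: segment_compact.
    exact: continuous_subspaceT.
  - lra.
  - exact: ck.
  by rewrite derive1E => dH dE; exact: (DeriveDef dH dE).
have [H1 H1E] : exists H : R -> R, forall t : R, is_derive t 1 H (h (Num.max t 0) - h 0).
  apply: half; last by move=> t t0; rewrite (max_idPr t0) subrr.
  suff ck (t : R) : {for t, continuous (fun t : R => h (Num.max t 0))}.
    by move=> t; exact: (continuous_fun_add (ck t) (@continuous_fun_cst _ (- h 0) t)).
  by apply: (@continuous_fun_comp _ (fun t : R => Num.max t 0) h); [exact: hcont|continuity_fun].
have [H2 H2E] : exists H : R -> R, forall t : R, is_derive t 1 H (h (- Num.max t 0) - h 0).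
  apply: half; last by move=> t t0; rewrite (max_idPr t0) oppr0 subrr.
  suff ck (t : R) : {for t, continuous (fun t : R => h (- Num.max t 0))}.
    by move=> t; exact: (continuous_fun_add (ck t) (@continuous_fun_cst _ (- h 0) t)).
  by apply: (@continuous_fun_comp _ (fun t : R => - Num.max t 0) h); [exact:
    hcont|continuity_fun].
exists (fun t => H1 t - H2 (- t) + h 0 * t) => t.
apply: is_derive_ex; eexists; split.
  exact: (is_derive_fun_add (is_derive_fun_add (H1E t) (is_derive_fun_opp (is_derive_fun_comp
    (H2E _) (is_derive_fun_opp (is_derive_fun_id t)))))
    (is_derive_fun_mul (is_derive_fun_cst _ t) (is_derive_fun_id t))).
have [t0|t0] := leP t 0.
  by rewrite (max_idPl _) ?opprK; [ring|lra].
rewrite (max_idPr _); last by lra.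
by rewrite oppr0; ring.
Unshelve. all: by end_near.
Qed.

End Calculus2.

(** * Scalar differential equations *)

Section ODE.
Context {R : realType}.
Implicit Types (f df u du g q : R -> R) (a b c t v x K T : R).

Lemma mean_value f df a b : a < b ->
  (forall x : R, a <= x <= b -> is_derive x 1 f (df x)) ->
  exists2 c, a < c < b & f b - f a = df c * (b - a).
Proof.
move=> ab fdf; have [||c] := @MVT _ f df a b ab.
- by move=> x; rewrite in_itv /= => /andP[? ?]; apply: fdf; rewrite !ltW.
- apply: continuous_in_subspaceT => x; rewrite inE /= in_itv /= => xab.
  exact: is_derive_continuous (fdf x xab).
by rewrite in_itv /= => cab ->; exists c.
Qed.

Lemma intermediate_value f a b v : a <= b -> (forall x, a <= x <= b -> {for x, continuous f}) ->
  f a <= v <= f b \/ f b <= v <= f a -> exists2 c, a <= c <= b & f c = v.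
Proof.
move=> ab cf fv; have [||c] := @IVT _ f a b v ab.
- by apply: continuous_in_subspaceT => x; rewrite inE /= in_itv /=; exact: cf.
- by rewrite minEle maxEle; case: ifP => h; case: fv => /andP[h1 h2]; lra.
by rewrite in_itv /=; exists c.
Qed.

(* Gronwall: [u ^+ 2 * expR (2 * K * t)] is nondecreasing and
   [u ^+ 2 * expR (- 2 * K * t)] is nonincreasing. *)
Lemma linear_growth_eq0 u du K T c :
  (forall t : R, t < T -> is_derive t 1 u (du t)) ->
  (forall t, t < T -> `|du t| <= K * `|u t|) ->
  c < T -> u c = 0 -> forall t, t < T -> u t = 0.
Proof.
move=> udu le cT uc t tT.
pose g k s := u s ^+ 2 * expR (2 * k * s).
pose dg k s := (2 * u s * du s + 2 * k * u s ^+ 2) * expR (2 * k * s).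
have gdg k (s : R) : s < T -> is_derive s 1 (g k) (dg k s).
  move=> sT; have := udu s sT => h.
  apply: is_derive_ex; eexists; split.
 by rewrite /g; derive_fun.
  by rewrite /dg /=; ring.
have bnd s : s < T -> - (K * u s ^+ 2) <= u s * du s <= K * u s ^+ 2.
  move=> sT; rewrite -ler_norml normrM -(real_normK (num_real (u s))) expr2 mulrCA.
  by apply: ler_wpM2l => //; exact: le.
suff [k] : exists k, g k t <= 0.
  rewrite /g pmulr_lle0 ?expR_gt0// => h.
  by apply/eqP; rewrite -sqrf_eq0 eq_le h sqr_ge0.
have g0 k : g k c = 0 by rewrite /g uc expr0n mul0r.
have [tc|ct|->] := ltgtP t c; last by exists 0; rewrite g0.
- exists K; have [|d /andP[td dc] e] := @mean_value (g K) (dg K) t c tc.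
    by move=> x /andP[_ xc]; apply: gdg; exact: le_lt_trans xc cT.
  have : 0 <= g K c - g K t.
    rewrite e mulr_ge0 ?subr_ge0 ?(ltW tc)//.
    have := bnd d (lt_trans dc cT); have := expR_ge0 (2 * K * d).
    by rewrite /dg => ? /andP[? _]; apply: mulr_ge0 => //; lra.
  by rewrite g0 sub0r oppr_ge0.
- exists (- K); have [|d /andP[cd dt] e] := @mean_value (g (- K)) (dg (- K)) c t ct.
    by move=> x /andP[_ xt]; apply: gdg; exact: le_lt_trans xt tT.
  have : g (- K) t - g (- K) c <= 0.
    rewrite e mulr_le0_ge0 ?subr_ge0 ?(ltW ct)//.
    have := bnd d (lt_trans dt tT); have := expR_ge0 (2 * - K * d).
    by rewrite /dg => ? /andP[_ ?]; apply: mulr_le0_ge0 => //; lra.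
  by rewrite g0 subr0.
Qed.

(** Quantities conserved along a solution of the unstable manifold receive their value from the
    equilibrium in this way. *)
Lemma cst_cvgNy f T l : (forall t : R, t < T -> is_derive t 1 f 0) ->
  f t @[t --> -oo] --> l -> forall t, t < T -> f t = l.
Proof.
move=> df fl t tT.
have : f s @[s --> -oo] --> f t.
  apply: (cvg_near_cst (f t)); near=> s.
  have st : s < t by near: s; by apply: nbhs_ninfty_lt; rewrite num_real.
  have [|c _] := @mean_value f (fun=> 0) s t st.
    by move=> x /andP[_ xt]; apply: df; exact: le_lt_trans xt tT.
  by rewrite mul0r => /eqP; rewrite subr_eq0 => /eqP ->.
by move=> h; apply: (cvg_unique _ h fl).
Unshelve. all: by end_near. Qed.

(** In the variable [w = ln s] the equation is [w' = k w] with [0 < k <= C]. The elapsed time [H],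
    an antiderivative of [1 / k], has slope at least [1 / C], hence is a bijection of the line; its
    inverse is the solution, defined for all times, and it tends to [-oo] in the past. *)
Lemma log_flow (v : R -> R) (C s0 : R) : continuous v ->
  (forall s, 0 < v s <= C) -> 0 < s0 ->
  exists s : R -> R, [/\ s 0 = s0, (forall t : R, is_derive t 1 s (s t * v (s t))),
    (forall t, 0 < s t) & s t @[t --> -oo] --> 0].
Proof.
move=> cv vC s00.
pose k w := v (expR w).
have k0 w : 0 < k w by have /andP[] := vC (expR w).
have [H0 dH0] : exists H : R -> R, forall t : R, is_derive t 1 H (k t)^-1.
  apply: (@antiderivative _ (fun w => (k w)^-1)) => w.
  have kw : {for w, continuous k} by exact: continuous_fun_comp (cv _) (@continuous_expR R w).
  by apply: (continuous_fun_inv _ kw); exact: lt0r_neq0.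
pose H w := H0 w - H0 (ln s0).
have dH (t : R) : is_derive t 1 H (k t)^-1.
  by apply: (is_derive_eq (is_derive_fun_add (dH0 t) (is_derive_fun_cst (- H0 (ln s0)) t)));
    exact: addr0.
have C0 : 0 < C by have /andP[h /(lt_le_trans h)] := vC 0.
have Hlt a b : a < b -> (b - a) / C <= H b - H a.
  move=> ab; have [c _ ->] := @mean_value H (fun w => (k w)^-1) a b ab (fun x _ => dH x).
  rewrite mulrC ler_pM2r ?subr_gt0// lef_pV2 ?posrE//.
  by have /andP[] := vC (expR c).
have Hinc a b : a < b -> H a < H b.
  by move=> ab; rewrite -subr_gt0; apply: lt_le_trans (Hlt _ _ ab); rewrite divr_gt0 ?subr_gt0.
have cH (t : R) : {for t, continuous H} by exact: is_derive_continuous (dH t).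
have Hsurj t : exists w, H w = t.
  have H00 : H (ln s0) = 0 by rewrite /H subrr.
  have Cn : 0 < C * (`|t| + 1) by rewrite mulr_gt0// ltr_wpDl.
  have h1 : `|t| + 1 <= H (ln s0 + C * (`|t| + 1)).
    have := @Hlt (ln s0) (ln s0 + C * (`|t| + 1)); rewrite ltrDl H00 subr0 => /(_ Cn).
    by rewrite addrAC subrr add0r mulrAC divff ?mul1r// gt_eqF.
  have h2 : H (ln s0 - C * (`|t| + 1)) <= - (`|t| + 1).
    have := @Hlt (ln s0 - C * (`|t| + 1)) (ln s0); rewrite gtrDl oppr_lt0 H00 sub0r => /(_ Cn).
    by rewrite opprB addrC subrK mulrAC divff ?mul1r 1?lerNr// gt_eqF.
  have [|||w _ Hw] := @intermediate_value H (ln s0 - C * (`|t| + 1)) (ln s0 + C * (`|t| + 1)) t.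
  - by lra.
  - by move=> x _; exact: cH.
  - by left; have := ler_norm t; have := lerNnormlW (lexx `|t|); lra.
  by exists w.
have [w Hw] := choice Hsurj.
have wH x : w (H x) = x.
  by have [h|h|//] := ltgtP (w (H x)) x; move/Hinc: h; rewrite Hw ltxx.
have dw (t : R) : is_derive t 1 w (k (w t)).
  rewrite -{1}(Hw t) -[X in is_derive _ _ _ X]invrK.
  apply: (@is_derive_inverse _ H w (k (w t))^-1 (w t)) => //.
  - by near=> y; exact: wH.
  - by near=> y; exact: cH.
  - by rewrite invr_eq0 gt_eqF.
exists (fun t => expR (w t)); split.
- by rewrite -[0](_ : H (ln s0) = 0) ?wH ?lnK// /H subrr.
- by move=> t; apply: is_derive_fun_expR; exact: dw.
- by move=> t; exact: expR_gt0.
apply/cvgrPdist_lt => e e0; near=> t.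
rewrite sub0r normrN gtr0_norm ?expR_gt0// -(lnK e0) ltr_expR.
have : t < H (ln e) by near: t; by apply: nbhs_ninfty_lt; rewrite num_real.
rewrite -{1}(Hw t) => h; rewrite ltNge; apply/negP; rewrite le_eqVlt => /predU1P[h'|/Hinc h'].
  by move: h; rewrite h' ltxx.
by move: (lt_trans h h'); rewrite ltxx.
Unshelve. all: by end_near. Qed.
(** Caratheodory's criterion supplies the factor at [a], and away from [a] it is a quotient of
    continuous functions. This removes the singularities at the saddle and at the turning points
    without second derivatives. *)
Lemma continuous_quotient f a b : continuous f -> is_derive a 1 f b -> f a = 0 ->
  exists q : R -> R, [/\ continuous q, forall z, f z = q z * (z - a) & q a = b].
Proof.
move=> cf /is_derive1_caratheodory[q [fq cq qa]] fa; exists q; split => //.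
  move=> x; have [->//|xa] := eqVneq x a.
  have xan : \forall z \near x, z != a := open_nbhs_nbhs (conj (@open_neq _ a) xa).
  have c0 : {for x, continuous (fun z => f z / (z - a))}.
    apply: continuous_fun_mul; [exact: cf|apply: continuous_fun_inv; first by rewrite subr_eq0].
    by continuity_fun.
  apply: (cvg_trans _ (_ : f z / (z - a) @[z --> x] --> q x)); last first.
    have -> : q x = f x / (x - a).
      by have := fq x; rewrite fa subr0 => ->; rewrite mulfK// subr_eq0.
    exact: c0.
  apply: near_eq_cvg; near=> z.
  have za : z != a by near: z; exact: xan.
  by have := fq z; rewrite fa subr0 => ->; rewrite mulfK// subr_eq0.
by move=> z; rewrite -fq fa subr0.
Unshelve. all: by end_near. Qed.

Lemma is_derive_quotient f q a : f a = 0 -> (forall z, f z = q z * (z - a)) ->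
  {for a, continuous q} -> is_derive a 1 f (q a).
Proof.
move=> fa fq cq; apply/is_derive1_caratheodory; exists q; split => // z.
by rewrite fa subr0 fq.
Qed.

(** The difference quotient of [f] is that of [g] divided by [f z + f a], which continuity keeps
    away from [0] near [a]; the sign of the root never has to be fixed. *)
Lemma is_derive_sqr_root f g a b : {for a, continuous f} -> f a != 0 ->
  (forall z, f z ^+ 2 = g z) -> is_derive a 1 g b -> is_derive a 1 f (b / (2 * f a)).
Proof.
move=> cf fa fg /is_derive1_caratheodory[q [gq cq qa]].
(* The first branch only makes the factorization valid at every [z]; close to [a] the second one is
   in force. *)
pose F z := if f z + f a == 0 then (f z - f a) / (z - a) else q z / (f z + f a).
apply/is_derive1_caratheodory; exists F; split.
- move=> z; rewrite /F; case: ifPn => [/eqP h|h].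
    have [->|za] := eqVneq z a; first by rewrite !subrr mulr0.
    by rewrite divfK// subr_eq0.
  by apply: (mulIf h); rewrite [RHS]mulrAC divfK// -gq -!fg; ring.
- have f2 : f a + f a != 0 by rewrite -mulr2n mulrn_eq0.
  have c0 : {for a, continuous (fun z => q z / (f z + f a))}.
    by apply: continuous_fun_mul => //; apply: continuous_fun_inv; last by continuity_fun.
  have Fa : F a = q a / (f a + f a) by rewrite /F (negbTE f2).
  have cF : F z @[z --> a] --> q a / (f a + f a).
    apply: cvg_trans c0; apply: near_eq_cvg; near=> z.
    have fz : f z != - f a.
      have : `|f a - f z| < `|f a|.
        by near: z; move/cvgrPdist_lt : cf; apply; rewrite normr_gt0.
      apply: contraTneq => ->.
      by rewrite opprK -leNgt -mulr2n normrMn mulr2n lerDl.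
    by rewrite /F addr_eq0 (negbTE fz).
  by rewrite -Fa in cF.
- rewrite /F ifF ?qa; last by apply/negbTE; rewrite -mulr2n mulrn_eq0.
  by rewrite mulr_natl mulr2n.
Unshelve. all: by end_near. Qed.

Lemma sin_le x : `|sin x| <= `|x|.
Proof.
wlog x0 : x / 0 < x => [h|].
  have [xn|xp|->] := ltgtP x 0; [|exact: h|by rewrite sin0].
  by rewrite -normrN -(normrN x) -sinN h// oppr_gt0.
have [c _] := @mean_value (@sin R) (@cos R) 0 x x0 (fun y _ => is_derive_sin y).
rewrite sin0 !subr0 => ->; rewrite normrM -[leRHS]mul1r.
by rewrite ler_wpM2r ?cos_max.
Qed.
End ODE.

(** * The reduced saddle *)

Section Pendulum.
Context {R : realType}.
Implicit Types (P Q r x s t : R).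

Lemma sinh0 : sinh (0 : R) = 0.
Proof. by rewrite /sinh oppr0 subrr mul0r. Qed.
Lemma cosh0 : cosh (0 : R) = 1.
Proof. by rewrite /cosh oppr0 expR0; lra. Qed.
Lemma sinhN x : sinh (- x) = - sinh x.
Proof. by rewrite /sinh opprK; ring. Qed.
Lemma coshN x : cosh (- x) = cosh x.
Proof. by rewrite /cosh opprK addrC. Qed.
Lemma sinh_gt0 x : 0 < x -> 0 < sinh x.
Proof. by move=> x0; rewrite divr_gt0// subr_gt0 ltr_expR; lra. Qed.

Lemma cosh2_sinh2 x : cosh x ^+ 2 - sinh x ^+ 2 = 1.
Proof.
have e : expR x * expR (- x) = 1 by rewrite -expRD subrr expR0.
by rewrite -[RHS]e /cosh /sinh; field.
Qed.

Definition potential P Q r x := P * sin x ^+ 2 - Q * sinh (r * x) ^+ 2.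
Definition force P Q r x := P * (sin x * cos x) - Q * r * (sinh (r * x) * cosh (r * x)).

Lemma is_derive_potential P Q r x : is_derive x 1 (potential P Q r) (2 * force P Q r x).
Proof.
have h1 := is_derive_fun_sin (is_derive_fun_id x).
have h2 := is_derive_fun_sinh (is_derive_fun_mul (is_derive_fun_cst r x) (is_derive_fun_id x)).
apply: is_derive_ex; eexists; split; first by rewrite /potential; derive_fun.
by rewrite /force /=; ring.
Qed.

Lemma continuous_force P Q r : continuous (force P Q r).
Proof.
move=> x; have h1 := is_derive_continuous (is_derive_fun_sin (is_derive_fun_id x)).
have h2 := is_derive_continuous (is_derive_fun_cos (is_derive_fun_id x)).
have h3 := is_derive_continuous (is_derive_fun_sinh (is_derive_fun_mul (is_derive_fun_cst r
  x) (is_derive_fun_id x))).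
have h4 := is_derive_continuous (is_derive_fun_cosh (is_derive_fun_mul (is_derive_fun_cst r
  x) (is_derive_fun_id x))).
suff: {for x, continuous (force P Q r)} by [].
by rewrite /force; continuity_fun.
Qed.

Lemma potentialN P Q r x : potential P Q r (- x) = potential P Q r x.
Proof. by rewrite /potential sinN mulrN sinhN !sqrrN. Qed.

Lemma forceN P Q r x : force P Q r (- x) = - force P Q r x.
Proof. by rewrite /force sinN cosN mulrN sinhN coshN; ring. Qed.

Lemma potential0 P Q r : potential P Q r 0 = 0.
Proof. by rewrite /potential sin0 mulr0 sinh0 expr0n !mulr0 subrr. Qed.

(* A [C^1] parametrization [s |-> (th s, y s)] of the unstable manifold of the
   saddle point [0] of [th'' = force th], along which the time evolution is the
   rescaled dilation [s' = s * v s]. *)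
Record unstable_param P Q r (th y dth dy v : R -> R) (C : R) : Prop := {
  up_dth : continuous dth;
  up_dy : continuous dy;
  up_v : continuous v;
  up_is_derive_th : forall s : R, is_derive s 1 th (dth s);
  up_is_derive_y : forall s : R, is_derive s 1 y (dy s);
  up_flow_th : forall s, s * v s * dth s = y s;
  up_flow_y : forall s, s * v s * dy s = force P Q r (th s);
  up_v_bound : forall s, 0 < v s <= C;
  up_immersion : forall s, (dth s != 0) || (dy s != 0);
  up_pi : forall s, `|th s| < pi;
  up_th0 : th 0 = 0;
  up_inj : forall s s', th s = th s' -> y s = y s' -> s = s';
  up_surj : forall (n m : R -> R) T, 0 < T ->
    (forall t : R, t < T -> is_derive t 1 n (m t)) ->
    (forall t, t < T -> {for t, continuous m}) ->
    n t @[t --> -oo] --> 0 ->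
    (forall t, t < T -> `|n t| < pi) ->
    (forall t, t < T -> m t ^+ 2 = potential P Q r (n t)) ->
    exists s, th s = n 0 /\ y s = m 0 }.

(* The separatrix of the mathematical pendulum, [th = 2 atan s]. *)
Lemma unstable_param_pendulum P Q r : 0 < P -> Q * r = 0 ->
  exists th y dth dy v C, unstable_param P Q r th y dth dy v C.
Proof.
move=> P0 Qr; set p := Num.sqrt P.
have p0 : 0 < p by rewrite sqrtr_gt0.
have pP : p ^+ 2 = P by rewrite sqr_sqrtr// ltW.
have d0 s : 1 + s ^+ 2 != 0 :> R by rewrite gt_eqF// ltr_pwDl// sqr_ge0.
have force_sin x : force P Q r x = P * (sin x * cos x).
  by rewrite /force Qr mul0r subr0.
have pot_sin x : potential P Q r x = (p * sin x) ^+ 2.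
  rewrite /potential [in RHS]exprMn pP; move/eqP: Qr; rewrite mulf_eq0 => /orP[] /eqP ->.
    by rewrite mul0r subr0.
  by rewrite mul0r sinh0 expr0n mulr0 subr0.
have sin2 s : sin (2 * atan s) = 2 * s / (1 + s ^+ 2).
  rewrite mulr_natl sin_mulr2n -[in RHS](atanK s) /tan.
  have c0 : cos (atan s) != 0.
    by rewrite cos_atan invr_eq0 gt_eqF// sqrtr_gt0 ltr_pwDl// sqr_ge0.
  have := cos2Dsin2 (atan s) => e.
  rewrite exprMn exprVn.
  rewrite (_ : 1 + _ = (cos (atan s) ^+ 2)^-1); last first.
    by rewrite -[RHS]mul1r -{2}e; field.
  by field.
have cos2 s : cos (2 * atan s) = (1 - s ^+ 2) / (1 + s ^+ 2).
  rewrite mulr_natl cos_mulr2n cos_atan exprVn sqr_sqrtr ?addr_ge0 ?sqr_ge0//.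
  by field.
have isd_den s : is_derive s 1 (fun s => (1 + s ^+ 2)^-1) (- (2 * s) / (1 + s ^+ 2) ^+ 2).
  have h : is_derive s 1 (fun s => 1 + s ^+ 2) (2 * s).
    by apply: is_derive_ex; eexists; split; [by derive_fun|rewrite /=; ring].
  exact: (is_derive_fun_inv (f := fun s => 1 + s ^+ 2) (d0 s) h).
have cden s : {for s, continuous (fun s => (1 + s ^+ 2)^-1)}.
  exact: is_derive_continuous (isd_den s).
exists (fun s => 2 * atan s), (fun s => p * (2 * s * (1 + s ^+ 2)^-1)).
exists (fun s => 2 * (1 + s ^+ 2)^-1).
exists (fun s => p * (2 * (1 - s ^+ 2) * ((1 + s ^+ 2)^-1 * (1 + s ^+ 2)^-1))).
exists (fun=> p), p; split.
- move=> s; suff : {for s, continuous (fun s => 2 * (1 + s ^+ 2)^-1)} by [].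
  have := cden s => h; by continuity_fun.
- move=> s; suff : {for s, continuous (fun s => p * (2 * (1 - s ^+ 2) *
    ((1 + s ^+ 2)^-1 * (1 + s ^+ 2)^-1)))} by [].
  have := cden s => h; by continuity_fun.
- exact: cst_continuous.
- move=> s; have h := is_derive1_atan s.
  by apply: is_derive_ex; eexists; split; [by derive_fun|rewrite /=; ring].
- move=> s; have h := isd_den s.
  by apply: is_derive_ex; eexists; split; [by derive_fun|rewrite /=; field].
- by move=> s; ring.
- by move=> s; rewrite force_sin sin2 cos2 -pP; field.
- by move=> s; rewrite p0 lexx.
- by move=> s; rewrite mulf_neq0 ?invr_eq0.
- move=> s; have := atan_gtNpi2 s; have := atan_ltpi2 s => h1 h2.
  by rewrite ltr_norml; apply/andP; split; lra.
- by rewrite atan0 mulr0.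
- by move=> s s' e _; apply: (can_inj (@atanK R)); lra.
(* The energy equation alone gives [m = p sin n] up to sign, that is, the stable and the unstable
   separatrix; the past limit selects the sign. *)
- move=> n m T T0 nm cm n0 npi mn.
  have absm t : t < T -> `|m t| = p * `|sin (n t)|.
    move=> tT; apply: (pexpIrn (n := 2)) => //; rewrite ?nnegrE ?mulr_ge0 ?(ltW p0)//.
    by rewrite real_normK ?num_real// mn// pot_sin exprMn [in RHS]exprMn real_normK ?num_real.
  have cn t : t < T -> {for t, continuous n} by move=> /nm; exact: is_derive_continuous.
  have [n00|n0n0] := eqVneq (n 0) 0.
    exists 0; rewrite atan0 !mulr0 !mul0r mulr0 n00; split => //.
    by apply/esym/normr0_eq0; rewrite absm// n00 sin0 normr0 mulr0.
  (* Since [|n'| = p |sin n| <= p |n|], a single zero of [n] would make it vanish identically. *)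
  have nn0 t : t < T -> n t != 0.
    move=> tT; apply: contra n0n0 => /eqP ntz; apply/eqP.
    apply: (@linear_growth_eq0 _ n m p T t) => // x xT.
    by rewrite absm// ler_wpM2l ?sin_le// ltW.
  have mn0 t : t < T -> m t != 0.
    move=> tT; rewrite -normr_gt0 absm// mulr_gt0// normr_gt0.
    have := nn0 t tT; have := npi t tT; rewrite ltr_norml => /andP[h1 h2].
    rewrite neq_lt => /orP[h|h].
      rewrite -[n t]opprK sinN oppr_eq0 gt_eqF// sin_gt0_pi//; apply/andP; split; lra.
    by rewrite gt_eqF// sin_gt0_pi// h.
  (* [n] moves away from [0], because it tends to [0] in the past. *)
  have nm0 : 0 < n 0 * m 0.
    have prod0 t : t < T -> n t * m t != 0 by move=> tT; rewrite mulf_neq0 ?nn0 ?mn0.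
    near (-oo : set_system R) => t.
    have t0 : t < 0 by near: t; apply: nbhs_ninfty_lt; rewrite num_real.
    have nt : `|n t| < `|n 0|.
      near: t; move/cvgrPdist_lt : n0 => /(_ `|n 0|); rewrite normr_gt0 => /(_ n0n0).
      by apply: filterS => t; rewrite sub0r normrN.
    have isd_n2 (x : R) : t <= x <= 0 -> is_derive x 1 (fun x => n x ^+ 2) (2 * (n x * m x)).
      move=> /andP[_ x0]; have := nm x (le_lt_trans x0 T0) => h.
      by apply: is_derive_ex; eexists; split; [by derive_fun|rewrite /=; ring].
    have [c /andP[tc c0] e] := mean_value t0 isd_n2.
    have cpos : 0 < n c * m c.
      have : 0 < n 0 ^+ 2 - n t ^+ 2.
        by rewrite subr_gt0 -(real_normK (num_real (n t))) -(real_normK (num_real (n 0)))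
          ltr_pXn2r ?nnegrE.
      by rewrite e sub0r pmulr_lgt0 ?oppr_gt0// pmulr_rgt0.
    rewrite lt_neqAle eq_sym prod0//= leNgt; apply/negP => neg.
    have [|||x /andP[_ x0] xe] := @intermediate_value _ (fun x => n x * m x) c 0 0.
    - exact: ltW.
    - move=> x /andP[_ x0]; have xT := le_lt_trans x0 T0.
      exact: continuous_fun_mul (cn x xT) (cm x xT).
    - by right; rewrite !ltW.
    by have := prod0 x (le_lt_trans x0 T0); rewrite xe eqxx.
  exists (tan (n 0 / 2)).
  have := npi 0 T0; rewrite ltr_norml => /andP[h1 h2].
  have th0 : 2 * atan (tan (n 0 / 2)) = n 0.
    by rewrite tanK; [field|rewrite in_itv /=; apply/andP; split; lra].
  split => //.
  rewrite -[2 * _ * _^-1]sin2 th0.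
  have := absm 0 T0; have [n0p|n0m|e] := ltgtP (n 0) 0; last by rewrite e eqxx in n0n0.
  + have m0 : m 0 < 0 by move: nm0; rewrite nmulr_rgt0.
    have sn : sin (n 0) < 0.
      by rewrite -[n 0]opprK sinN oppr_lt0 sin_gt0_pi//; apply/andP; split; lra.
    by rewrite !ltr0_norm// mulrN => /oppr_inj.
  + have m0 : 0 < m 0 by move: nm0; rewrite pmulr_rgt0.
    have sn : 0 < sin (n 0) by rewrite sin_gt0_pi//; apply/andP; split; lra.
    by rewrite !gtr0_norm.
Unshelve. all: by end_near. Qed.
End Pendulum.

(** * The figure eight: turning points and rational parametrization of the loops *)

Section Homoclinic.
Context {R : realType}.
Variables (P Q r : R).
Hypotheses (P0 : 0 < P) (Q0 : 0 < Q) (r0 : 0 < r) (saddle : Q * r ^+ 2 < P).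
Implicit Types (x s t : R).
Let F := potential P Q r.
Let h := force P Q r.

(** The Wronskian of [sin x] and [sinh (r * x)], that is, the numerator of the derivative of
    [sinh (r * x) / sin x]. *)
Let wronskian x := r * cosh (r * x) * sin x - cos x * sinh (r * x).

(** It vanishes at [0], and its derivative [(r ^ 2 + 1) sinh (r z) sin z] is positive between [0]
    and [pi]. *)
Let wronskian_gt0 x : 0 < x -> x < pi -> 0 < wronskian x.
Proof.
move=> x0 xpi.
pose d z := (r ^+ 2 + 1) * (sinh (r * z) * sin z).
have isd_w (z : R) : 0 <= z <= x -> is_derive z 1 wronskian (d z).
  move=> _; have rz := is_derive_fun_mul (is_derive_fun_cst r z) (is_derive_fun_id z).
  have h1 := is_derive_fun_sin (is_derive_fun_id z); have h2 := is_derive_fun_cos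
    (is_derive_fun_id z).
  have h3 := is_derive_fun_sinh rz; have h4 := is_derive_fun_cosh rz.
  by apply: is_derive_ex; eexists; split; [rewrite /wronskian; derive_fun|rewrite /d /=; ring].
have [c /andP[c0 cx]] := mean_value x0 isd_w.
rewrite {2}/wronskian sin0 !mulr0 sinh0 mulr0 !subr0 => ->.
rewrite mulr_gt0// mulr_gt0 ?ltr_wpDl ?sqr_ge0// mulr_gt0 ?sinh_gt0 ?mulr_gt0//.
by rewrite sin_gt0_pi// c0 (lt_trans cx).
Qed.

(** The ratio is [P - Q (sinh (r x) / sin x) ^ 2], whose monotonicity is the sign of the Wronskian.
    Hence [F] changes sign at most once between [0] and [pi]. *)
Let ratio_decr x z : 0 < x -> x < z -> z < pi ->
  F z / sin z ^+ 2 < F x / sin x ^+ 2.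
Proof.
move=> x0 xz zpi.
pose d u := - (2 * Q * sinh (r * u) * wronskian u / sin u ^+ 3).
have isd_ratio (u : R) : x <= u <= z -> is_derive u 1 (fun u => F u / sin u ^+ 2) (d u).
  move=> /andP[xu uz]; have su : sin u != 0.
    by rewrite gt_eqF// sin_gt0_pi// (lt_le_trans x0)//= (le_lt_trans uz).
  have h1 := is_derive_potential P Q r u.
  have h2 : is_derive u 1 (fun u => sin u ^+ 2) (2 * sin u * cos u).
    have h2 := is_derive_fun_sin (is_derive_fun_id u).
    by apply: is_derive_ex; eexists; split; [by derive_fun|rewrite /=; ring].
  have h3 := is_derive_fun_inv (f := fun u : R => sin u ^+ 2) (expf_neq0 2 su) h2.
  apply: is_derive_ex; eexists; split; first by derive_fun.
  by rewrite /d /wronskian /F /force /potential /=; field.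
have [c /andP[xc cz] e] := mean_value xz isd_ratio.
rewrite -subr_lt0 e nmulr_rlt0 ?subr_gt0// /d oppr_lt0.
have c0 := lt_trans x0 xc; have cpi := lt_trans cz zpi.
have shc : 0 < sinh (r * c) by rewrite sinh_gt0 ?mulr_gt0.
apply: divr_gt0; last by apply/exprn_gt0/sin_gt0_pi; rewrite c0.
apply: mulr_gt0 (wronskian_gt0 c0 cpi); apply: mulr_gt0 shc; exact: mulr_gt0.
Qed.

Let sin_pos x : 0 < x -> x < pi -> 0 < sin x.
Proof. by move=> x0 xpi; rewrite sin_gt0_pi// x0. Qed.

Let F_continuous x : {for x, continuous F}.
Proof. exact: is_derive_continuous (is_derive_potential P Q r x). Qed.

(** Both terms of [F] are squares of functions with a zero at [0], so squaring their first-order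
    quotients gives [M]. By [saddle], [M 0] is positive. *)
Let F_quotient : exists M : R -> R, [/\ continuous M,
  forall z, F z = M z * z ^+ 2 & M 0 = P - Q * r ^+ 2].
Proof.
have [q1 [c1 e1 q10]] := continuous_quotient (@continuous_sin R) (is_derive_sin 0) (@sin0 R).
have isd_shr (x : R) : is_derive x 1 (fun x => sinh (r * x)) (cosh (r * x) * r).
  apply: (is_derive_eq (is_derive_fun_sinh (is_derive_fun_mul (is_derive_fun_cst r x)
    (is_derive_fun_id x)))).
  by rewrite mul0r add0r mulr1.
have [||q2 [c2 e2 q20]] := continuous_quotient _ (isd_shr 0).
- by move=> x; exact: is_derive_continuous (isd_shr x).
- by rewrite mulr0 sinh0.
exists (fun x => P * q1 x ^+ 2 - Q * q2 x ^+ 2); split.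
- move=> x; suff : {for x, continuous (fun x => P * q1 x ^+ 2 - Q * q2 x ^+ 2)} by [].
  by have h1 := c1 x; have h2 := c2 x; continuity_fun.
- by move=> z; rewrite /F /potential e1 e2 !subr0; ring.
- by rewrite q10 q20 cos0 mulr0 cosh0 expr1n mulr1 mul1r.
Qed.

(** [F] is positive just after [0] and negative at [pi]; the decreasing ratio makes the sign change
    unique. As [F' = 2 h], the bound [h a < 0] says that the zero is simple, which later gives the
    immersion at the turning points. *)
Let turning_point : exists a, [/\ 0 < a < pi, F a = 0,
  (forall x, 0 < x -> x < a -> 0 < F x), (forall x, a < x -> x < pi -> F x < 0) & h a < 0].
Proof.
have pi0 := pi_gt0 R.
have [M [cM FM M0]] := F_quotient.
have [b [b0 bpi Fb]] : exists b, [/\ 0 < b, b < pi & 0 < F b].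
  have Mpos : 0 < M 0 by rewrite M0 subr_gt0.
  near (0 : R)^'+ => b; exists b.
  have b0 : 0 < b by near: b; exact: nbhs_right_gt.
  split => //.
  rewrite FM mulr_gt0 ?exprn_gt0//; near: b.
  apply: (@cvgr_gt _ _ _ _ M (M 0)) => //.
  exact: cvg_at_right_filter (cM 0).
have Fpi : F pi < 0.
  by rewrite /F /potential sinpi expr0n mulr0 sub0r oppr_lt0 mulr_gt0// exprn_gt0// sinh_gt0
    ?mulr_gt0.
have [|||a /andP[ba a_le_pi] Fa] := @intermediate_value _ F b pi 0; first exact: ltW.
- by move=> x _; exact: F_continuous.
- by right; rewrite !ltW.
have a0 : 0 < a := lt_le_trans b0 ba.
have api : a < pi.
  by rewrite lt_neqAle a_le_pi andbT; apply: contraTneq Fpi => <-; rewrite Fa ltxx.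
exists a; split => //.
- by rewrite a0.
- move=> x x0 xa; have := ratio_decr x0 xa api; rewrite Fa mul0r.
  by rewrite pmulr_lgt0// invr_gt0 exprn_gt0// sin_pos// (lt_trans xa).
- move=> x ax xpi; have := ratio_decr a0 ax xpi; rewrite Fa mul0r.
  by rewrite pmulr_llt0// invr_gt0 exprn_gt0// sin_pos// (lt_trans a0).
- have sa := sin_pos a0 api.
  rewrite -(pmulr_llt0 _ sa).
  rewrite (_ : h a * sin a = cos a * F a - Q * (sinh (r * a) * wronskian a)); last first.
    by rewrite /h /force /F /potential /wronskian; ring.
  by rewrite Fa mulr0 sub0r oppr_lt0 mulr_gt0// mulr_gt0 ?wronskian_gt0// sinh_gt0 ?mulr_gt0.
Unshelve. all: by end_near. Qed.

Lemma unstable_param_homoclinic :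
  exists th y dth dy v C, unstable_param P Q r th y dth dy v C.
Proof.
have [a [/andP[a0 api] Fa Fpos Fneg ha]] := turning_point.
have [M [cM FM M0]] := F_quotient.
have a1 : a != 0 by rewrite gt_eqF.
have Ma : M a = 0.
  by apply: (mulIf (expf_neq0 2 a1)); rewrite mul0r -FM.
have isd_M : is_derive a 1 M (2 * h a / a ^+ 2).
  have nz : \forall z \near a, z != 0.
    exact: (open_nbhs_nbhs (conj (@open_neq _ 0) a1)).
  have eq : \forall z \near a, F z * (z ^+ 2)^-1 = M z.
    by apply: filterS nz => z z0; rewrite FM mulfK// expf_neq0.
  apply: (near_eq_is_derive eq).
  have h1 := is_derive_potential P Q r a.
  have h2 := is_derive_fun_inv (f := fun z : R => z ^+ 2) (expf_neq0 2 a1) (is_derive_fun_exp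
    1 (is_derive_fun_id a)).
  apply: (is_derive_eq (is_derive_fun_mul h1 h2)).
  by rewrite -/F Fa mul0r addr0 /h.
have [q [cq Mq qa]] := continuous_quotient cM isd_M Ma.
(* What remains of [F] once the double zero at [0] and the simple zeros at [a] and [- a] are divided
   out, see [Fm]. The absolute value makes it even, so that the quotient [q] at [a] alone serves
   both turning points. *)
pose m x := - (a ^+ 2 * q `|x|) / (`|x| + a).
have na x : `|x| + a != 0 by rewrite gt_eqF// ltr_wpDl.
have cm : continuous m.
  move=> x; suff : {for x, continuous m} by [].
  have h0 : {for x, continuous (fun x : R => `|x|)} by exact: norm_continuous.
  have h1 : {for x, continuous (fun x => q `|x|)} := continuous_fun_comp (f := fun x => `|x|)
    (cq _) h0.
  have h2 : {for x, continuous (fun x => (`|x| + a)^-1)}.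
    by apply: (continuous_fun_inv (f := fun x => `|x| + a)) => //; continuity_fun.
  by rewrite /m; continuity_fun.
have qneg x : 0 <= x -> x <= a -> q x < 0.
  move=> x0; rewrite le_eqVlt => /predU1P[->|xa].
    by rewrite qa pmulr_llt0 ?invr_gt0 ?exprn_gt0// pmulr_rlt0.
  have : 0 < M x.
    move: x0; rewrite le_eqVlt => /predU1P[<-|x0]; first by rewrite M0 subr_gt0.
    by have := Fpos x x0 xa; rewrite FM pmulr_lgt0// exprn_gt0.
  by rewrite Mq nmulr_lgt0// subr_lt0.
have m_gt0 x : `|x| <= a -> 0 < m x.
  move=> xa; rewrite /m divr_gt0 ?ltr_wpDl// oppr_gt0 pmulr_rlt0 ?exprn_gt0//.
  exact: qneg.
have m_even x : m (- x) = m x by rewrite /m normrN.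
have Fm x : F x * a ^+ 2 = m x * x ^+ 2 * (a ^+ 2 - x ^+ 2).
  have -> : F x = F `|x| by case: (ger0P x) => _; rewrite /F ?potentialN.
  rewrite FM Mq -(real_normK (num_real x)) /m.
  have := na x => ?; field => //.
have ma : m a = - h a / a.
  by rewrite /m gtr0_norm// qa; field; rewrite a1 -mulr2n mulrn_eq0.
have m0 : m 0 = P - Q * r ^+ 2.
  by rewrite /m normr0 add0r -M0 Mq sub0r; field.
(* Half-angle parametrization of a circle of radius [a]: the companion coordinate
   [a (1 - s ^ 2) / (1 + s ^ 2)] is a square root of [a ^ 2 - th ^ 2]. *)
pose th s := a * (2 * s / (1 + s ^+ 2)).
have d0 s : 1 + s ^+ 2 != 0 :> R by rewrite gt_eqF// ltr_pwDl// sqr_ge0.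
have th0 : th 0 = 0 by rewrite /th mulr0 mul0r mulr0.
have tha s : a ^+ 2 - th s ^+ 2 = (a * ((1 - s ^+ 2) / (1 + s ^+ 2))) ^+ 2.
  by rewrite /th; field.
have th_le s : `|th s| <= a.
  rewrite -(@ler_pXn2r _ 2) ?nnegrE ?(ltW a0)// real_normK ?num_real//.
  by rewrite -subr_ge0 tha sqr_ge0.
pose v s := Num.sqrt (m (th s)).
have v_gt0 s : 0 < v s by rewrite sqrtr_gt0 m_gt0.
have v0 s : v s != 0 by rewrite gt_eqF.
have v2 s : v s ^+ 2 = m (th s) by rewrite sqr_sqrtr// ltW// m_gt0.
pose y s := th s * ((1 - s ^+ 2) / (1 + s ^+ 2)) * v s.
have y2 s : y s ^+ 2 = F (th s).
  apply: (mulIf (expf_neq0 2 a1)); rewrite Fm tha /y -v2; field => //.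
have [k [ck hk k0]] : exists k : R -> R, [/\ continuous k, forall z, h z = k z * z & k 0 = m 0].
  have isd_h0 : is_derive (0 : R) 1 h (m 0).
    have i0 := is_derive_fun_id (0 : R); have ri := is_derive_fun_mul (is_derive_fun_cst r 0) i0.
    have h1 := is_derive_fun_sin i0; have h2 := is_derive_fun_cos i0.
    have h3 := is_derive_fun_sinh ri; have h4 := is_derive_fun_cosh ri.
    apply: is_derive_ex; eexists; split; first by rewrite /h /force; derive_fun.
    by rewrite /= m0 sin0 cos0 !mulr0 sinh0 cosh0; ring.
  have h0 : h 0 = 0 by rewrite /h /force sin0 !mulr0 sinh0 mul0r mulr0 mul0r mulr0 subrr.
  have [k [ck hk k0]] := continuous_quotient (@continuous_force R P Q r) isd_h0 h0.
  by exists k; split => // z; rewrite {1}/h hk subr0.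
pose dth s := a * (2 * (1 - s ^+ 2) / (1 + s ^+ 2) ^+ 2).
(* The value forced by [s v dy = h (th s)], with the factor [s] cancelled through
   [h z = k z * z]. *)
pose dy s := k (th s) * (2 * a) / ((1 + s ^+ 2) * v s).
have isd_th (s : R) : is_derive s 1 th (dth s).
  have i1 : is_derive s 1 (fun s => 1 + s ^+ 2) (2 * s).
    by apply: is_derive_ex; eexists; split; [by derive_fun|rewrite /=; ring].
  have i2 := is_derive_fun_inv (f := fun s => 1 + s ^+ 2) (d0 s) i1.
  apply: is_derive_ex; eexists; split; first by rewrite /th; derive_fun.
  by rewrite /dth /=; field.
have cth (s : R) : {for s, continuous th} := is_derive_continuous (isd_th s).
have cv : continuous v.
  move=> s.
  have h1 : {for s, continuous (fun s => m (th s))} := continuous_fun_comp (cm _) (cth s).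
  exact: continuous_fun_comp (@sqrt_continuous _ _) h1.
have cden s : {for s, continuous (fun s => (1 + s ^+ 2)^-1)}.
  by apply: (continuous_fun_inv (f := fun s => 1 + s ^+ 2)) => //; continuity_fun.
have cdth : continuous dth.
  move=> s; suff : {for s, continuous (fun s => a * (2 * (1 - s ^+ 2) / (1 + s ^+ 2) ^+ 2))}
    by [].
  have c2 : {for s, continuous (fun s => ((1 + s ^+ 2) ^+ 2)^-1)}.
    by apply: (continuous_fun_inv (f := fun s => (1 + s ^+ 2) ^+ 2)); [rewrite
      expf_neq0|continuity_fun].
  by continuity_fun.
have cdy : continuous dy.
  move=> s; suff : {for s, continuous dy} by [].
  have c1 : {for s, continuous (fun s => k (th s))} := continuous_fun_comp (ck _) (cth s).
  have c2 : {for s, continuous (fun s => ((1 + s ^+ 2) * v s)^-1)}.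
    have cvs := cv s.
    by apply: (continuous_fun_inv (f := fun s => (1 + s ^+ 2) * v s)); [rewrite
      mulf_neq0|continuity_fun].
  by rewrite /dy; continuity_fun.
have flow s : s * v s * dth s = y s by rewrite /dth /y /th; field.
have flow_y s : s * v s * dy s = h (th s).
  by rewrite /dy hk [X in _ = _ * X]/th; field; rewrite v0 d0.
have isd_y (s : R) : is_derive s 1 y (dy s).
  have cy : {for s, continuous y}.
    have c1 := cth s; have c2 := cden s; have c3 := cv s.
    by rewrite /y; continuity_fun.
  have [s0|s0] := eqVneq s 0.
    pose g s := a * (2 / (1 + s ^+ 2)) * ((1 - s ^+ 2) / (1 + s ^+ 2)) * v s.
    have cg : {for 0, continuous g}.
      have c2 := cden 0; have c3 := cv 0.
      by rewrite /g; continuity_fun.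
    have -> : dy s = g 0.
      have m00 : m 0 = v 0 ^+ 2 by rewrite v2 th0.
      by rewrite s0 /dy th0 k0 m00 /g; field; rewrite v0.
    rewrite s0; apply: is_derive_quotient => //.
      by rewrite /y th0 !mul0r.
    by move=> z; rewrite /y /g /th; field.
  have [s1|s1] := eqVneq (s ^+ 2) 1.
    have ss : s = s^-1 by apply: (mulfI s0); rewrite -expr2 s1 divff.
    have ths : th s = a * s by rewrite /th s1; field.
    pose g z := - (th z * (z + s) / (1 + z ^+ 2) * v z).
    have cg : {for s, continuous g}.
      have c1 := cth s; have c2 := cden s; have c3 := cv s.
      by rewrite /g; continuity_fun.
    (* After multiplication by [s v], oddness of [h] and evenness of [m] move everything to [a],
       where [ma] concludes. *)
    have -> : dy s = g s.
      have : s * v s * dy s = s * v s * g s.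
        rewrite flow_y ths.
        have -> : h (a * s) = s * h a.
          by move/eqP : s1; rewrite sqrf_eq1 => /orP[] /eqP ->; rewrite ?mulr1 ?mul1r//
            mulrN1 mulN1r /h forceN.
        have -> : s * v s * g s = - (a * s * s ^+ 2 / (1 + s ^+ 2) * v s ^+ 2 * 2).
          by rewrite /g ths; ring.
        rewrite v2 ths.
        have -> : m (a * s) = m a.
          by move/eqP : s1; rewrite sqrf_eq1 => /orP[] /eqP ->; rewrite ?mulr1// mulrN1 m_even.
        by rewrite ma s1; field.
      by move/mulfI; apply; rewrite mulf_neq0.
    apply: is_derive_quotient => //.
      by rewrite /y s1 subrr mul0r mulr0 mul0r.
    by move=> z; rewrite /y /g -{1}s1; field.
  have ns1 : 1 - s ^+ 2 != 0 by rewrite subr_eq0 eq_sym.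
  have dth0 : dth s != 0 by rewrite /dth !mulf_neq0 ?invr_eq0 ?expf_neq0.
  have y0 : y s != 0 by rewrite -flow; apply: mulf_neq0 dth0; exact: mulf_neq0.
  have isd_F : is_derive s 1 (fun s => F (th s)) (2 * h (th s) * dth s).
    exact: is_derive_fun_comp (is_derive_potential P Q r (th s)) (isd_th s).
  apply: (is_derive_eq (is_derive_sqr_root cy y0 y2 isd_F)).
  rewrite -flow_y -flow; field.
  by rewrite dth0 v0 s0.
have [C vC] : exists C, forall s, v s <= C.
  have aa : - a <= a by lra.
  have [c _ cmax] := EVT_max aa (continuous_subspaceT cm).
  exists (Num.sqrt (m c)) => s; apply: ler_wsqrtr; apply: cmax.
  by rewrite in_itv /= -ler_norml.
exists th, y, dth, dy, v, C; split => //.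
- by move=> s; rewrite v_gt0 vC.
- move=> s; have [s1|s1] := eqVneq (s ^+ 2) 1; last first.
    have ns1 : 1 - s ^+ 2 != 0 by rewrite subr_eq0 eq_sym.
    by apply/orP; left; rewrite /dth !mulf_neq0 ?invr_eq0 ?expf_neq0.
  apply/orP; right; apply/eqP => e.
  have ths : th s = a * s by rewrite /th s1; field.
  have := flow_y s; rewrite e mulr0 ths => /esym/eqP; apply/negP.
  move/eqP : s1; rewrite sqrf_eq1 => /orP[] /eqP ->; first by rewrite mulr1 lt_eqF.
  by rewrite mulrN1 /h forceN oppr_eq0 lt_eqF.
- by move=> s; exact: le_lt_trans (th_le s) api.
- move=> s s' ths ys.
  have [s0|s0] := eqVneq (th s) 0.
    have z u : th u = 0 -> u = 0.
      rewrite /th => /eqP.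
      by rewrite mulf_eq0 (negbTE a1) !mulf_eq0 invr_eq0 (negbTE (d0 u)) pnatr_eq0 orbF => /eqP.
    by rewrite (z s)// (z s')// -ths.
  have vs : v s = v s' by rewrite /v ths.
  have e1 : (1 - s ^+ 2) / (1 + s ^+ 2) = (1 - s' ^+ 2) / (1 + s' ^+ 2).
    by move: ys; rewrite /y vs ths => /(mulIf (v0 s')) /mulfI; apply; rewrite -ths.
  have e2 : s ^+ 2 = s' ^+ 2.
    have h1 : (1 - s ^+ 2) * (1 + s' ^+ 2) = (1 - s' ^+ 2) * (1 + s ^+ 2).
      by move/eqP : e1; rewrite eqr_div// => /eqP.
    by lra.
  move: ths; rewrite /th e2 => /(mulfI a1) /(mulIf (invr_neq0 (d0 s'))); lra.
(* The loops fill the zero-energy level with [|x| < pi]: negativity of [F] beyond [a] confines [x]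
   to the range of [th]. *)
- move=> n w T T0 _ _ _ npi wn.
  have := npi 0 T0; have := wn 0 T0; move: (n 0) (w 0) => x z zx xpi.
  have xa : `|x| <= a.
    rewrite leNgt; apply/negP => ax.
    have := Fneg _ ax xpi; have -> : F `|x| = F x.
      by case: (ger0P x) => _; rewrite /F ?potentialN.
    by rewrite /F -zx ltNge sqr_ge0.
  have [x0|x0] := eqVneq x 0.
    exists 0; rewrite /y th0 !mul0r x0; split => //.
    by apply/esym/eqP; rewrite -sqrf_eq0 zx x0 potential0.
  have mx := m_gt0 _ xa; set u := Num.sqrt (m x).
  have u0 : 0 < u by rewrite sqrtr_gt0.
  have u2 : u ^+ 2 = m x by rewrite sqr_sqrtr// ltW.
  (* [(x / a, kap)] lies on the unit circle, as sine and cosine of an angle; [s] below is the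
     tangent of half that angle, and the excluded [kap = -1] would force [x = 0]. *)
  pose kap := z / (x * u).
  have kap2 : (x / a) ^+ 2 + kap ^+ 2 = 1.
    rewrite /kap !exprMn !exprVn exprMn u2 zx.
    have -> : potential P Q r x = m x * x ^+ 2 * (a ^+ 2 - x ^+ 2) / a ^+ 2.
      by rewrite -Fm mulfK// expf_neq0.
    by field; rewrite a1 x0 gt_eqF.
  have kap1 : 1 + kap != 0.
    apply: contra_neq x0 => kap0.
    have k1 : kap = -1 by lra.
    have : (x / a) ^+ 2 = 0 by move: kap2; rewrite k1 sqrrN expr1n; lra.
    by move/eqP; rewrite sqrf_eq0 mulf_eq0 invr_eq0 (negbTE a1) orbF => /eqP.
  pose s := x / a / (1 + kap).
  have s2 : 1 + s ^+ 2 = 2 / (1 + kap).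
    have xa2 : (x / a) ^+ 2 = 1 - kap ^+ 2 by lra.
    by rewrite /s expr_div_n xa2; field.
  have ths : th s = x.
    by rewrite /th s2 /s; field; rewrite kap1 a1.
  have vs : v s = u by rewrite /v ths.
  exists s; split => //.
  have -> : z = x * kap * u by rewrite /kap; field; rewrite x0 gt_eqF.
  rewrite /y ths vs s2 (_ : 1 - s ^+ 2 = 2 - 2 / (1 + kap)); last by rewrite -s2; ring.
  by field; rewrite kap1.
Qed.
End Homoclinic.

Lemma unstable_paramP {R : realType} (P Q r : R) : 0 < P -> 0 <= Q -> 0 <= r ->
  Q * r ^+ 2 < P -> exists th y dth dy v C, unstable_param P Q r th y dth dy v C.
Proof.
move=> P0; rewrite le_eqVlt => /predU1P[<- _ _|Q0].
  by apply: unstable_param_pendulum; rewrite ?mul0r.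
rewrite le_eqVlt => /predU1P[<- _|r0 saddle].
  by apply: unstable_param_pendulum; rewrite ?mulr0.
exact: unstable_param_homoclinic.
Qed.

(** * Coordinatewise limits and derivatives of row vectors *)

Section Matrices.
Context {R : realType}.

Lemma cvg_mxP {T : Type} {F : set_system T} {FF : Filter F} {m n : nat}
    (M : T -> 'M[R]_(m, n)) (L : 'M[R]_(m, n)) :
  M t @[t --> F] --> L <-> forall i j, M t i j @[t --> F] --> L i j.
Proof.
split=> [ML i j|ML].
  exact: (cvg_comp M (fun A : 'M[R]_(m, n) => A i j) ML (@coord_continuous R m n i j L)).
apply/cvgrPdist_le => e e0; near=> t.
rewrite [leLHS]/Num.Def.normr/= mx_normrE (bigmax_le _ (ltW e0))//= => -[i j] _.
rewrite !mxE/=; move: i j.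
suff : forall ij : 'I_m * 'I_n, `|L ij.1 ij.2 - M t ij.1 ij.2| <= e by move=> h i j; exact:
  (h (i, j)).
near: t; apply: filter_forall => -[i j] /=.
by have /cvgrPdist_le := ML i j; apply.
Unshelve. all: by end_near. Qed.

Lemma is_derive_mxP {V : normedModType R} {m n : nat} (M : V -> 'M[R]_(m, n))
    (t v : V) (D : 'M[R]_(m, n)) :
  is_derive t v M D <-> forall i j, is_derive t v (fun x => M x i j) (D i j).
Proof.
split=> [[dM <-] i j|h].
  rewrite derive_mx// mxE; apply: DeriveDef => //.
  by move/derivable_mxP : dM; apply.
have dM : derivable M t v by apply/derivable_mxP => i j; case: (h i j).
apply: DeriveDef => //; rewrite derive_mx//; apply/matrixP => i j.
by rewrite mxE; case: (h i j).
Qed.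

Lemma differentiable_rowP {V : normedModType R} {n : nat} (f : V -> 'rV[R]_n) (p : V) :
  (forall j, differentiable (fun x => f x 0 j) p) -> differentiable f p.
Proof.
move=> df.
rewrite (_ : f = \sum_(j < n) (fun x => f x 0 j *: (delta_mx 0 j : 'rV[R]_n))).
  by apply: differentiable_sum => j; apply: differentiableZl; exact: df.
apply/funext => x; rewrite fct_sumE; exact: row_sum_delta.
Qed.

Lemma is_derive_lineP {V W : normedModType R} (f : V -> W) (p v : V) (D : W) :
  is_derive (0 : R) 1 (fun h => f (h *: v + p)) D -> is_derive p v f D.
Proof.
case=> d e; split; first by apply/derivable1P.
rewrite -e /derive; set g1 := fun h => h^-1 *: _; set g2 := fun h => h^-1 *: _.
suff -> : g1 = g2 by [].
by rewrite funeqE /g1 /g2 => h /=; rewrite addr0 scale0r add0r [_%:A]mulr1.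
Qed.

Lemma differentiable_coord_row {n : nat} (i : 'I_n) (p : 'rV[R]_n) :
  differentiable (fun x : 'rV[R]_n => x 0 i) p.
Proof. exact: differentiable_coord. Qed.

Lemma forall_coord5 (A : 'I_5 -> Prop) :
  A i_k -> A i_m -> A i_n -> A i_mt -> A i_kt -> forall i, A i.
Proof.
move=> h1 h2 h3 h4 h5 -[[|[|[|[|[|//]]]]] i].
- by rewrite (_ : Ordinal i = i_k)//; exact/val_inj.
- by rewrite (_ : Ordinal i = i_m)//; exact/val_inj.
- by rewrite (_ : Ordinal i = i_n)//; exact/val_inj.
- by rewrite (_ : Ordinal i = i_mt)//; exact/val_inj.
- by rewrite (_ : Ordinal i = i_kt)//; exact/val_inj.
Qed.

Lemma row5P (x y : 'rV[R]_5) : x 0 i_k = y 0 i_k -> x 0 i_m = y 0 i_m ->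
  x 0 i_n = y 0 i_n -> x 0 i_mt = y 0 i_mt -> x 0 i_kt = y 0 i_kt -> x = y.
Proof. by move=> h1 h2 h3 h4 h5; apply/rowP; exact: forall_coord5. Qed.

Lemma stateE (a b c d e : R) : [/\ state a b c d e 0 i_k = a, state a b c d e 0 i_m = b,
  state a b c d e 0 i_n = c, state a b c d e 0 i_mt = d & state a b c d e 0 i_kt = e].
Proof. by split; rewrite mxE. Qed.

Lemma is_derive_state (a b c d e : R -> R) (a' b' c' d' e' t : R) :
  is_derive t 1 a a' -> is_derive t 1 b b' -> is_derive t 1 c c' ->
  is_derive t 1 d d' -> is_derive t 1 e e' ->
  is_derive t 1 (fun t => state (a t) (b t) (c t) (d t) (e t)) (state a' b' c' d' e').
Proof.
move=> h1 h2 h3 h4 h5; apply/is_derive_mxP => i j; rewrite (ord1 i).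
move: j; apply: forall_coord5; have [E1 E2 E3 E4 E5] := stateE a' b' c' d' e'.
- by rewrite E1 (_ : (fun x => _) = a)//; apply/funext => x; rewrite mxE.
- by rewrite E2 (_ : (fun x => _) = b)//; apply/funext => x; rewrite mxE.
- by rewrite E3 (_ : (fun x => _) = c)//; apply/funext => x; rewrite mxE.
- by rewrite E4 (_ : (fun x => _) = d)//; apply/funext => x; rewrite mxE.
- by rewrite E5 (_ : (fun x => _) = e)//; apply/funext => x; rewrite mxE.
Qed.

Lemma cvg_state {T : Type} {F : set_system T} {FF : Filter F}
    (a b c d e : T -> R) (a' b' c' d' e' : R) :
  a t @[t --> F] --> a' -> b t @[t --> F] --> b' -> c t @[t --> F] --> c' ->
  d t @[t --> F] --> d' -> e t @[t --> F] --> e' ->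
  state (a t) (b t) (c t) (d t) (e t) @[t --> F] --> state a' b' c' d' e'.
Proof.
move=> h1 h2 h3 h4 h5; apply/cvg_mxP => i j; rewrite (ord1 i).
move: j; apply: forall_coord5; have [E1 E2 E3 E4 E5] := stateE a' b' c' d' e'.
- by rewrite E1 (_ : (fun x => _) = a)//; apply/funext => x; rewrite mxE.
- by rewrite E2 (_ : (fun x => _) = b)//; apply/funext => x; rewrite mxE.
- by rewrite E3 (_ : (fun x => _) = c)//; apply/funext => x; rewrite mxE.
- by rewrite E4 (_ : (fun x => _) = d)//; apply/funext => x; rewrite mxE.
- by rewrite E5 (_ : (fun x => _) = e)//; apply/funext => x; rewrite mxE.
Qed.
End Matrices.

(** * The unstable manifold *)

(** The resonant field with free coefficients: only sign conditions on their products enter the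
    analysis. *)
Definition quad_field {R : realType} (c1 c2 c3 c4 c5 c6 : R) (x : 'rV[R]_5) : 'rV[R]_5 :=
  state (c1 * x 0 i_m * x 0 i_n) (c2 * x 0 i_n * x 0 i_k)
        (c3 * x 0 i_k * x 0 i_m + c6 * x 0 i_kt * x 0 i_mt)
        (c4 * x 0 i_n * x 0 i_kt) (c5 * x 0 i_mt * x 0 i_n).

Section UnstableManifold.
Context {R : realType}.
Variables (c1 c2 c3 c4 c5 c6 k0 l0 : R).
(** [c12] makes (a_k, a_m) rotate and [c45] makes (a_kt, a_mt) move hyperbolically. [c456] covers
    the degenerate case [Gt = 0], where the second pair is constant. *)
Hypotheses (c12 : c1 * c2 < 0) (c23 : 0 < c2 * c3) (c45 : 0 <= c4 * c5)
  (c46 : c4 * c6 <= 0) (c456 : c4 * c5 = 0 -> [/\ c4 = 0, c5 = 0 & c6 = 0]).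
Hypothesis saddle : 0 < k0 ^+ 2 * (c2 * c3) + l0 ^+ 2 * (c4 * c6).
Let f := quad_field c1 c2 c3 c4 c5 c6.
Let w := Num.sqrt (- (c1 * c2)).
Let nu := Num.sqrt (c4 * c5).
Let r := nu / w.
Let P := k0 ^+ 2 * (c2 * c3).
(** When [nu = 0], division by zero yields [0], so [Q], [r] and the ratio [c4 / nu] in [lift]
    vanish, as the decoupled case requires. *)
Let Q := - (l0 ^+ 2 * (c4 * c6) * w ^+ 2 / nu ^+ 2).
Implicit Types (x y s t T : R).

Let w_gt0 : 0 < w. Proof. by rewrite sqrtr_gt0 oppr_gt0. Qed.
Let w2 : w ^+ 2 = - (c1 * c2). Proof. by rewrite sqr_sqrtr// oppr_ge0 ltW. Qed.
Let nu2 : nu ^+ 2 = c4 * c5. Proof. by rewrite sqr_sqrtr. Qed.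
Let w_neq0 : w != 0. Proof. by rewrite gt_eqF. Qed.
Let c2_neq0 : c2 != 0.
Proof. by apply: contraTneq c12 => ->; rewrite mulr0 ltxx. Qed.

Let nu0P : nu = 0 -> [/\ c4 = 0, c5 = 0 & c6 = 0].
Proof. by move=> nu0; apply: c456; rewrite -nu2 nu0 expr0n. Qed.

Let P_gt0 : 0 < P.
Proof.
apply: lt_le_trans saddle _; rewrite /P gerDl.
by rewrite mulr_ge0_le0// sqr_ge0.
Qed.

Let k0_neq0 : k0 != 0.
Proof. by apply: contraTneq P_gt0 => ke; rewrite /P ke expr0n mul0r ltxx. Qed.

Let Q_ge0 : 0 <= Q.
Proof.
rewrite /Q oppr_ge0 mulr_le0_ge0 ?invr_ge0 ?sqr_ge0// mulr_le0_ge0 ?sqr_ge0//.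
by rewrite mulr_ge0_le0// sqr_ge0.
Qed.

Let r_ge0 : 0 <= r. Proof. by rewrite divr_ge0// ?sqrtr_ge0// ltW. Qed.

Let PQr : Q * r ^+ 2 < P.
Proof.
have [nu0|nu0] := eqVneq nu 0; first by rewrite /r nu0 mul0r expr0n mulr0.
rewrite (_ : Q * r ^+ 2 = - (l0 ^+ 2 * (c4 * c6))); last first.
  by rewrite /Q /r; field; rewrite nu0 w_neq0.
by rewrite /P -subr_gt0 opprK.
Qed.

(* The unstable manifold in terms of the angle [x] of [(a_k, a_m)] and its
   velocity [y]. *)
Let lift x y : 'rV[R]_5 := state (k0 * cos x) (k0 * (c2 / w) * sin x) (y / w)
  (l0 * (c4 / nu) * sinh (r * x)) (l0 * cosh (r * x)).

Let lift' x y dx dy : 'rV[R]_5 := state (k0 * (- sin x * dx))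
  (k0 * (c2 / w) * (cos x * dx)) (dy / w)
  (l0 * (c4 / nu) * (cosh (r * x) * (r * dx))) (l0 * (sinh (r * x) * (r * dx))).

Let lift00 : lift 0 0 = state k0 0 0 0 l0.
Proof. by rewrite /lift cos0 sin0 !mulr0 sinh0 cosh0 mul0r !mulr0 !mulr1. Qed.

Let isd_lift (th y : R -> R) (dx dy : R) t : is_derive t 1 th dx -> is_derive t 1 y dy ->
  is_derive t 1 (fun t => lift (th t) (y t)) (lift' (th t) (y t) dx dy).
Proof.
move=> hth hy.
have i1 := is_derive_fun_sin hth; have i2 := is_derive_fun_cos hth.
have hr : is_derive t 1 (fun t => r * th t) (r * dx).
  by apply: is_derive_ex; eexists; split; [by derive_fun|rewrite /=; ring].
have i3 := is_derive_fun_sinh hr; have i4 := is_derive_fun_cosh hr.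
apply: is_derive_state; apply: is_derive_ex; eexists; split; try (by derive_fun); by rewrite
  /=; ring.
Qed.

(** With [c1 = - w ^ 2 / c2] and, for nonzero [nu], [c5 = nu ^ 2 / c4], the field is the image under
    the differential of [lift] of the reduced field [x' = y], [y' = force x]. Solutions of the
    reduced equation thus lift to solutions. *)
Let field_lift x y : f (lift x y) = lift' x y y (force P Q r x).
Proof.
have [E1 E2 E3 E4 E5] := stateE (k0 * cos x) (k0 * (c2 / w) * sin x) (y / w)
  (l0 * (c4 / nu) * sinh (r * x)) (l0 * cosh (r * x)).
have cw : c1 = - w ^+ 2 / c2 by rewrite w2; field.
rewrite /f /quad_field /lift E1 E2 E3 E4 E5 /lift'; congr (state _ _ _ _ _).
- by rewrite cw; field; rewrite w_neq0 c2_neq0.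
- by field.
- rewrite /force /P /Q /r; have [nu0|nu0] := eqVneq nu 0; last by field; rewrite w_neq0.
  have [-> _ ->] := nu0P nu0; rewrite !(mul0r, mulr0, oppr0, subr0, addr0).
  by field; rewrite w_neq0.
- rewrite /r; have [nu0|nu0] := eqVneq nu 0; last by field; rewrite w_neq0.
  by have [-> _ _] := nu0P nu0; rewrite !(mul0r, mulr0).
- rewrite /r; have [nu0|nu0] := eqVneq nu 0.
    by have [_ -> _] := nu0P nu0; rewrite nu0 !(mul0r, mulr0).
  have c40 : c4 != 0.
    by apply: contraTneq nu0 => c40; rewrite /nu c40 mul0r sqrtr0 eqxx.
  have -> : c5 = nu ^+ 2 / c4 by rewrite nu2; field.
  by field; rewrite w_neq0 nu0 c40.
Qed.

(** [cos] determines [|x|] below [pi], [sin] then decides the sign, and a_n gives [y]. *)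
Let lift_inj x y x' y' : `|x| < pi -> `|x'| < pi -> lift x y = lift x' y' ->
  x = x' /\ y = y'.
Proof.
move=> xpi xpi' e.
have [E1 E2 E3 _ _] := stateE (k0 * cos x) (k0 * (c2 / w) * sin x) (y / w)
  (l0 * (c4 / nu) * sinh (r * x)) (l0 * cosh (r * x)).
have [E1' E2' E3' _ _] := stateE (k0 * cos x') (k0 * (c2 / w) * sin x') (y' / w)
  (l0 * (c4 / nu) * sinh (r * x')) (l0 * cosh (r * x')).
have ec : cos x = cos x'.
  by apply: (mulfI k0_neq0); rewrite -E1 -E1' -!/(lift _ _) e.
have es : sin x = sin x'.
  apply: (mulfI (_ : k0 * (c2 / w) != 0)); first by rewrite !mulf_neq0 ?invr_eq0.
  by rewrite -E2 -E2' -!/(lift _ _) e.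
split; last first.
  by apply: (mulIf (invr_neq0 w_neq0)); rewrite -E3 -E3' -!/(lift _ _) e.
have abs : `|x| = `|x'|.
  apply: cos_inj; rewrite ?in_itv /= ?normr_ge0 ?ltW//.
  by rewrite !cos_norm.
move/eqP : abs; rewrite eqr_norm2 => /orP[/eqP//|/eqP xx'].
have s0 : sin x' = 0 by move: es; rewrite xx' sinN; lra.
suff x'0 : x' = 0 by rewrite xx' x'0 oppr0.
move: xpi'; rewrite ltr_norml => /andP[h1 h2].
have [h|h|//] := ltgtP x' 0.
  have : 0 < sin (- x') by rewrite sin_gt0_pi//; apply/andP; split; lra.
  by rewrite sinN s0 oppr0 ltxx.
have : 0 < sin x' by rewrite sin_gt0_pi// h.
by rewrite s0 ltxx.
Qed.

Let lift'_neq0 x y dx dy : (dx != 0) || (dy != 0) -> lift' x y dx dy != 0.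
Proof.
have [E1 E2 E3 _ _] := stateE (k0 * (- sin x * dx))
  (k0 * (c2 / w) * (cos x * dx)) (dy / w)
  (l0 * (c4 / nu) * (cosh (r * x) * (r * dx))) (l0 * (sinh (r * x) * (r * dx))).
move=> h; apply/eqP => e.
move: E1 E2 E3; rewrite -/(lift' x y dx dy) e !mxE => /esym/eqP e1 /esym/eqP e2 /esym/eqP e3.
case/orP: h => h; last by move: e3; rewrite mulf_eq0 invr_eq0 (negbTE h) (negbTE w_neq0).
move: e1 e2; rewrite !mulf_eq0 (negbTE h) (negbTE k0_neq0) (negbTE c2_neq0) invr_eq0 (negbTE
  w_neq0) /= !orbF oppr_eq0.
move=> /eqP s0 /eqP co0; have := cos2Dsin2 x; rewrite s0 co0 !expr0n addr0 => /esym/eqP.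
by rewrite oner_eq0.
Qed.

Let W := unstable_manifold f (state k0 0 0 0 l0).

(** The curve is run through by [s' = s v(s)]: [log_flow] handles [s0 > 0], its reflection [s0 < 0],
    and [s0 = 0] is the equilibrium itself. The solution exists for all times, so [T = 1] will
    do. *)
Let lift_subset (th y dth dy v : R -> R) (C : R) :
  unstable_param P Q r th y dth dy v C -> forall s, W (lift (th s) (y s)).
Proof.
move=> U s0; have y0 : y 0 = 0 by rewrite -(up_flow_th U) !mul0r.
have cth s : {for s, continuous th} := is_derive_continuous (up_is_derive_th U s).
have cy s : {for s, continuous y} := is_derive_continuous (up_is_derive_y U s).
suff [sg [s00 dsg sglim]] : exists sg : R -> R, [/\ sg 0 = s0,
    (forall t : R, is_derive t 1 sg (sg t * v (sg t))) & sg t @[t --> -oo] --> 0].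
  exists (fun t => lift (th (sg t)) (y (sg t))), 1; split => //.
  - move=> t _; rewrite field_lift.
    have i1 := is_derive_fun_comp (up_is_derive_th U (sg t)) (dsg t).
    have i2 := is_derive_fun_comp (up_is_derive_y U (sg t)) (dsg t).
    apply: (is_derive_eq (isd_lift i1 i2)).
    by rewrite -(up_flow_y U) -(up_flow_th U) ![_ * (sg t * v (sg t))]mulrC.
  - by rewrite s00.
  - rewrite (_ : state k0 0 0 0 l0 = lift (th 0) (y 0)); last by rewrite (up_th0 U) y0 lift00.
    have cc : {for 0, continuous (fun s => lift (th s) (y s))}.
      have i := isd_lift (up_is_derive_th U 0) (up_is_derive_y U 0).
      by apply/differentiable_continuous/derivable1_diffP; case: i.
    exact: (cvg_comp sg (fun s => lift (th s) (y s)) sglim cc).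
have [s0n|s0p|->] := ltgtP s0 0.
- have cvN : continuous (fun s => v (- s)).
    move=> s; suff : {for s, continuous (fun s => v (- s))} by [].
    by apply: (continuous_fun_comp (f := fun s => - s)); [exact: (up_v U)|continuity_fun].
  have Ns0 : 0 < - s0 by rewrite oppr_gt0.
  have [sg [h1 h2 h3 h4]] := log_flow cvN (fun s => up_v_bound U (- s)) Ns0.
  exists (fun t => - sg t); split; first by rewrite h1 opprK.
    by move=> t; apply: (is_derive_eq (is_derive_fun_opp (h2 t))); rewrite mulNr.
  by rewrite -oppr0; exact: cvgN.
- have [sg [h1 h2 h3 h4]] := log_flow (up_v U) (up_v_bound U) s0p.
  by exists sg.
- exists (fun=> 0); split => //; last exact: cvg_cst.
  by move=> t; apply: (is_derive_eq (is_derive_fun_cst 0 t)); rewrite mul0r.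
Qed.
Let Ninfty_lt T : \forall t \near -oo, t < T.
Proof. by apply: nbhs_ninfty_lt; rewrite num_real. Qed.

Let isd_coord (a : R -> 'rV[R]_5) t D i : is_derive t 1 a D ->
  is_derive t 1 (fun t => a t 0 i) (D 0 i).
Proof. by move=> /is_derive_mxP. Qed.

(** The angle is recovered as the antiderivative of [w a_n] that vanishes at [-oo]; undoing the two
    rotations by it leaves constants, which are read off at the equilibrium. *)
Let subset_lift (a : R -> 'rV[R]_5) T : 0 < T -> is_solution f [set t | t < T] a ->
  a t @[t --> -oo] --> state k0 0 0 0 l0 ->
  exists (n m : R -> R) T', [/\ 0 < T', forall t : R, t < T' -> is_derive t 1 n (m t),
    forall t, t < T' -> {for t, continuous m}, n t @[t --> -oo] --> 0 &
    forall t, t < T' -> a t = lift (n t) (m t)].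
Proof.
move=> T0 sol lim.
have [L1 L2 L3 L4 L5] := stateE k0 0 0 0 l0.
have limc i : a t 0 i @[t --> -oo] --> state k0 0 0 0 l0 0 i.
  by move/cvg_mxP : lim; apply.
pose ak t := a t 0 i_k; pose am t := a t 0 i_m; pose an t := a t 0 i_n.
pose bm t := a t 0 i_mt; pose bk t := a t 0 i_kt.
have lk : ak t @[t --> -oo] --> k0 by rewrite -L1; exact: limc.
have lm : am t @[t --> -oo] --> 0 by rewrite -L2; exact: limc.
have ln : an t @[t --> -oo] --> 0 by rewrite -L3; exact: limc.
have lbm : bm t @[t --> -oo] --> 0 by rewrite -L4; exact: limc.
have lbk : bk t @[t --> -oo] --> l0 by rewrite -L5; exact: limc.
have dk (t : R) : t < T -> is_derive t 1 ak (c1 * am t * an t).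
  by move=> /sol /isd_coord - /(_ i_k) h; apply: (is_derive_eq h); rewrite mxE.
have dm (t : R) : t < T -> is_derive t 1 am (c2 * an t * ak t).
  by move=> /sol /isd_coord - /(_ i_m) h; apply: (is_derive_eq h); rewrite mxE.
have dn (t : R) : t < T -> is_derive t 1 an (c3 * ak t * am t + c6 * bk t * bm t).
  by move=> /sol /isd_coord - /(_ i_n) h; apply: (is_derive_eq h); rewrite mxE.
have dbm (t : R) : t < T -> is_derive t 1 bm (c4 * an t * bk t).
  by move=> /sol /isd_coord - /(_ i_mt) h; apply: (is_derive_eq h); rewrite mxE.
have dbk (t : R) : t < T -> is_derive t 1 bk (c5 * bm t * an t).
  by move=> /sol /isd_coord - /(_ i_kt) h; apply: (is_derive_eq h); rewrite mxE.
pose T' := T / 2.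
have T'0 : 0 < T' by rewrite divr_gt0.
have T'T : T' < T by rewrite /T'; lra.
have ltT t : t < T' -> t < T by move=> h; exact: lt_trans T'T.
(* [an] is known to be continuous only before [T], whereas [antiderivative] wants a function on the
   whole line; [clamp t] is the minimum of [t] and [T']. *)
pose clamp t := - Num.max (- t) (- T').
have clampE t : t < T' -> clamp t = t.
  by move=> tT; rewrite /clamp (max_idPl _) ?opprK// lerN2 ltW.
have clamp_lt t : clamp t < T.
  rewrite /clamp; apply: le_lt_trans T'T; rewrite lerNl le_max lexx orbT//.
have cclamp t : {for t, continuous clamp} by rewrite /clamp; continuity_fun.
have can t : t < T -> {for t, continuous an} by move=> /dn; exact: is_derive_continuous.
have [n0 dn0] : exists n0 : R -> R, forall t : R, is_derive t 1 n0 (w * an (clamp t)).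
  apply: (@antiderivative _ (fun t => w * an (clamp t))) => t.
  suff : {for t, continuous (fun t => w * an (clamp t))} by [].
  have h := continuous_fun_comp (can _ (clamp_lt t)) (cclamp t).
  by continuity_fun.
have dn1 (t : R) : t < T' -> is_derive t 1 n0 (w * an t).
  by move=> tT; have := dn0 t; rewrite clampE.
(* Rescaled so that (a_k, M) undergoes a Euclidean rotation of speed [w a_n]. *)
pose M t := w / c2 * am t.
have lM : M t @[t --> -oo] --> 0.
  by rewrite -(mulr0 (w / c2)); apply: cvgM => //; exact: cvg_cst.
have dM (t : R) : t < T -> is_derive t 1 M (w * an t * ak t).
  move=> tT; have h := dm t tT; apply: is_derive_ex; eexists; split; first by rewrite /M;
    derive_fun.
  by rewrite /=; field.
have dk' (t : R) : t < T -> is_derive t 1 ak (- (w * an t * M t)).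
  move=> tT; apply: (is_derive_eq (dk t tT)); rewrite /M.
  have -> : c1 = - w ^+ 2 / c2 by rewrite w2; field.
  by field.
(* Near [-oo] the angle is [atan (M / ak)], hence [n0] has a limit there. *)
have [l nl] : exists l : R, n0 t @[t --> -oo] --> l.
  have k1 : \forall t \near -oo, `|k0 - ak t| < `|k0|.
    by move/cvgrPdist_lt : lk; apply; rewrite normr_gt0.
  have [T1 [_ hT1]] : exists T1, T1 \is Num.real /\ forall t, t < T1 -> `|k0 - ak t| < `|k0|.
    by case: k1 => T1 [r1 h1]; exists T1.
  pose T2 := Num.min T1 T'.
  have ak0 t : t < T2 -> ak t != 0.
    rewrite lt_min => /andP[/hT1 h _]; apply: contraTneq h => ->.
    by rewrite subr0 ltxx.
  have T2T' t : t < T2 -> t < T' by rewrite lt_min => /andP[].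
  pose d t := n0 t - atan (M t / ak t).
  have dd (t : R) : t < T2 -> is_derive t 1 d 0.
    move=> t2; have a0 := ak0 t t2; have tT' := T2T' t t2; have tT := ltT t tT'.
    have h1 := is_derive_fun_mul (dM t tT) (is_derive_fun_inv a0 (dk' t tT)).
    have h2 := is_derive_fun_comp (g := fun t => M t / ak t) (is_derive1_atan (M t / ak t)) h1.
    apply: (is_derive_eq (is_derive_fun_add (dn1 t tT') (is_derive_fun_opp h2))).
    have den : ak t ^+ 2 + M t ^+ 2 != 0.
      by rewrite gt_eqF// ltr_pwDl ?sqr_ge0// exprn_even_gt0.
    have -> : 1 + (M t / ak t) ^+ 2 = (ak t ^+ 2 + M t ^+ 2) / ak t ^+ 2 by field.
    by field; rewrite a0 den.
  have l0' : atan (M t / ak t) @[t --> -oo] --> 0.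
    rewrite -(@atan0 R); apply: (cvg_comp (fun t => M t / ak t)); last exact: continuous_atan.
    rewrite -(mul0r k0^-1); apply: cvgM => //; exact: cvgV.
  near (-oo : set_system R) => t1.
  have t12 : t1 < T2 by near: t1; exact: Ninfty_lt.
  have dcst t : t < T2 -> d t = d t1.
    move=> t2.
    have [tt|tt|->//] := ltgtP t t1.
    - have [c _] := @mean_value _ d (fun=> 0) t t1 tt
        (fun x xt => dd x (le_lt_trans (andP xt).2 t12)).
      by rewrite mul0r => /eqP; rewrite subr_eq0 => /eqP.
    - have [c _] := @mean_value _ d (fun=> 0) t1 t tt
        (fun x xt => dd x (le_lt_trans (andP xt).2 t2)).
      by rewrite mul0r => /eqP; rewrite subr_eq0 => /eqP.
  exists (d t1 + 0).
  have h : d t1 + atan (M t / ak t) @[t --> -oo] --> d t1 + 0.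
    by apply: cvgD => //; exact: cvg_cst.
  apply: cvg_trans h; apply: near_eq_cvg.
  near=> t; have t2 : t < T2 by near: t; exact: Ninfty_lt.
  by rewrite -(dcst t t2) /d subrK.
pose n t := n0 t - l; pose m t := w * an t.
have lim_n : n t @[t --> -oo] --> 0.
  by rewrite -(subrr l); apply: cvgB => //; exact: cvg_cst.
have dn2 (t : R) : t < T' -> is_derive t 1 n (m t).
  move=> tT; apply: (is_derive_eq (is_derive_fun_add (dn1 t tT) (is_derive_fun_cst (- l) t))).
  by rewrite addr0.
have lcos : cos (n t) @[t --> -oo] --> (1 : R).
  by rewrite -(@cos0 R); exact: cvg_comp lim_n (@continuous_cos R 0).
have lsin : sin (n t) @[t --> -oo] --> (0 : R).
  by rewrite -(@sin0 R); exact: cvg_comp lim_n (@continuous_sin R 0).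
(* [rot1] and [rot2] are the coordinates of (a_k, M) turned back by the angle [n]. *)
have rot1 t : t < T' -> ak t * cos (n t) + M t * sin (n t) = k0.
  apply: (@cst_cvgNy _ (fun t => ak t * cos (n t) + M t * sin (n t))).
    move=> s sT; have h1 := dk' s (ltT s sT); have h2 := dM s (ltT s sT).
    have h3 := is_derive_fun_cos (dn2 s sT); have h4 := is_derive_fun_sin (dn2 s sT).
    by apply: is_derive_ex; eexists; split; [by derive_fun|rewrite /m /=; ring].
  rewrite (_ : k0 = k0 * 1 + 0 * 0); last by rewrite mulr1 mulr0 addr0.
  by apply: cvgD; apply: cvgM.
have rot2 t : t < T' -> M t * cos (n t) - ak t * sin (n t) = 0.
  apply: (@cst_cvgNy _ (fun t => M t * cos (n t) - ak t * sin (n t))).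
    move=> s sT; have h1 := dk' s (ltT s sT); have h2 := dM s (ltT s sT).
    have h3 := is_derive_fun_cos (dn2 s sT); have h4 := is_derive_fun_sin (dn2 s sT).
    by apply: is_derive_ex; eexists; split; [by derive_fun|rewrite /m /=; ring].
  rewrite (_ : 0 = 0 * 1 - k0 * 0); last by rewrite mulr0 mul0r subr0.
  by apply: cvgB; apply: cvgM.
exists n, m, T'; split => //.
  by move=> t tT; rewrite /m; have := can t (ltT t tT) => h; continuity_fun.
move=> t tT; have e := cos2Dsin2 (n t); have r1 := rot1 t tT; have r2 := rot2 t tT.
have [E1 E2 E3 E4 E5] := stateE (k0 * cos (n t)) (k0 * (c2 / w) * sin (n t)) (m t / w)
  (l0 * (c4 / nu) * sinh (r * n t)) (l0 * cosh (r * n t)).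
have ekk : ak t = k0 * cos (n t).
  rewrite -r1 -[LHS]mulr1 -e; move: r2 => /eqP; rewrite subr_eq0 => /eqP r2.
  transitivity (ak t * cos (n t) ^+ 2 + (ak t * sin (n t)) * sin (n t)); first by ring.
  by rewrite -r2; ring.
have eM : M t = k0 * sin (n t).
  rewrite -r1 -[LHS]mulr1 -e; move: r2 => /eqP; rewrite subr_eq0 => /eqP r2.
  transitivity (M t * sin (n t) ^+ 2 + (M t * cos (n t)) * cos (n t)); first by ring.
  by rewrite r2; ring.
suff [ebm ebk] : bm t = l0 * (c4 / nu) * sinh (r * n t) /\ bk t = l0 * cosh (r * n t).
  apply: row5P; rewrite ?E1 ?E2 ?E3 ?E4 ?E5 //.
  - by rewrite -[LHS]/(am t) mulrAC -eM /M; field; rewrite w_neq0.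
  - by rewrite -[LHS]/(an t) /m; field.
have [nu0|nu0] := eqVneq nu 0.
  have [c40 c50 c60] := nu0P nu0.
  have cst1 : bm t = 0.
    apply: (@cst_cvgNy _ bm T') => // s sT.
    by apply: (is_derive_eq (dbm s (ltT s sT))); rewrite c40 !mul0r.
  have cst2 : bk t = l0.
    apply: (@cst_cvgNy _ bk T') => // s sT.
    by apply: (is_derive_eq (dbk s (ltT s sT))); rewrite c50 !mul0r.
  by rewrite cst1 cst2 /r nu0 c40 !mul0r mulr0 mul0r cosh0 mulr1.
have c4_neq0 : c4 != 0.
  by apply: contraTneq nu0 => c40; rewrite /nu c40 mul0r sqrtr0 eqxx.
pose B t := nu / c4 * bm t.
have lB : B t @[t --> -oo] --> 0.
  by rewrite -(mulr0 (nu / c4)); apply: cvgM => //; exact: cvg_cst.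
have dB (u : R) : u < T -> is_derive u 1 B (nu * an u * bk u).
  move=> uT; have h := dbm u uT; apply: is_derive_ex; eexists; split; first by rewrite /B;
    derive_fun.
  by rewrite /=; field.
have dbk' (u : R) : u < T -> is_derive u 1 bk (nu * an u * B u).
  move=> uT; apply: (is_derive_eq (dbk u uT)); rewrite /B.
  have -> : c5 = nu ^+ 2 / c4 by rewrite nu2; field.
  by field.
have drn (u : R) : u < T' -> is_derive u 1 (fun t => r * n t) (nu * an u).
  move=> uT; apply: (is_derive_eq (is_derive_fun_mul (is_derive_fun_cst r u) (dn2 u uT))).
  by rewrite /m /r; field.
have lrn : r * n t @[t --> -oo] --> 0.
  by rewrite -(mulr0 r); apply: cvgM => //; exact: cvg_cst.
have cch : {for 0, continuous (@cosh R)} := is_derive_continuous (is_derive_fun_cosh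
  (is_derive_fun_id 0)).
have csh : {for 0, continuous (@sinh R)} := is_derive_continuous (is_derive_fun_sinh
  (is_derive_fun_id 0)).
have lch : cosh (r * n t) @[t --> -oo] --> (1 : R).
  by rewrite -(@cosh0 R); exact: (cvg_comp (fun t => r * n t) (@cosh R) lrn cch).
have lsh : sinh (r * n t) @[t --> -oo] --> (0 : R).
  by rewrite -(@sinh0 R); exact: (cvg_comp (fun t => r * n t) (@sinh R) lrn csh).
(* The same argument with a hyperbolic rotation of parameter [r n]. *)
have hyp1 : bk t * cosh (r * n t) - B t * sinh (r * n t) = l0.
  apply: (@cst_cvgNy _ (fun t => bk t * cosh (r * n t) - B t * sinh (r * n t)) T') => //.
    move=> s sT; have h1 := dbk' s (ltT s sT); have h2 := dB s (ltT s sT).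
    have h3 := is_derive_fun_cosh (drn s sT); have h4 := is_derive_fun_sinh (drn s sT).
    by apply: is_derive_ex; eexists; split; [by derive_fun|rewrite /m /=; ring].
  rewrite (_ : l0 = l0 * 1 - 0 * 0); last by rewrite mulr1 mulr0 subr0.
  by apply: cvgB; apply: cvgM.
have hyp2 : B t * cosh (r * n t) - bk t * sinh (r * n t) = 0.
  apply: (@cst_cvgNy _ (fun t => B t * cosh (r * n t) - bk t * sinh (r * n t)) T') => //.
    move=> s sT; have h1 := dbk' s (ltT s sT); have h2 := dB s (ltT s sT).
    have h3 := is_derive_fun_cosh (drn s sT); have h4 := is_derive_fun_sinh (drn s sT).
    by apply: is_derive_ex; eexists; split; [by derive_fun|rewrite /m /=; ring].
  rewrite (_ : 0 = 0 * 1 - l0 * 0); last by rewrite mulr0 mul0r subr0.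
  by apply: cvgB; apply: cvgM.
move/eqP : hyp2; rewrite subr_eq0 => /eqP hyp2.
have ech := cosh2_sinh2 (r * n t).
have eB : B t = l0 * sinh (r * n t).
  rewrite -hyp1 -[LHS]mulr1 -ech.
  transitivity ((B t * cosh (r * n t)) * cosh (r * n t) - B t * sinh (r * n t) ^+ 2); first
    by ring.
  by rewrite hyp2; ring.
split.
  by rewrite mulrAC -eB /B; field; rewrite nu0 c4_neq0.
rewrite -hyp1 -[LHS]mulr1 -ech.
transitivity (bk t * cosh (r * n t) ^+ 2 - (bk t * sinh (r * n t)) * sinh (r * n t)); first
  by ring.
by rewrite -hyp2; ring.
Unshelve. all: by end_near. Qed.
(** [(w a_n) ^ 2 - potential (n)] has derivative [2 m (force - force) = 0] and tends to [0] in the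
    past. *)
Let energy (a : R -> 'rV[R]_5) (n m : R -> R) T : 0 < T ->
  is_solution f [set t | t < T] a ->
  (forall t : R, t < T -> is_derive t 1 n (m t)) -> n t @[t --> -oo] --> 0 ->
  a t @[t --> -oo] --> state k0 0 0 0 l0 ->
  (forall t, t < T -> a t = lift (n t) (m t)) ->
  forall t, t < T -> m t ^+ 2 = potential P Q r (n t).
Proof.
move=> T0 sol dn lim_n lim alift t0 t0T.
have [_ _ L3 _ _] := stateE k0 0 0 0 l0.
have an t : t < T -> a t 0 i_n = m t / w by move=> tT; rewrite alift// mxE.
have da (t : R) : t < T -> is_derive t 1 (fun t => a t 0 i_n) (force P Q r (n t) / w).
  move=> tT; have h := isd_coord i_n (sol t tT).
  by apply: (is_derive_eq h); rewrite alift// field_lift mxE.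
have lan : a t 0 i_n @[t --> -oo] --> (0 : R).
  by move/cvg_mxP : lim => /(_ 0 i_n); rewrite L3.
have cpot : {for 0, continuous (potential P Q r)} := is_derive_continuous
  (is_derive_potential P Q r 0).
suff : (w * a t0 0 i_n) ^+ 2 - potential P Q r (n t0) = 0.
  by rewrite an// mulrC divfK// => /eqP; rewrite subr_eq0 => /eqP.
apply: (@cst_cvgNy _ (fun t => (w * a t 0 i_n) ^+ 2 - potential P Q r (n t)) T) => //.
  move=> t tT; have h1 := da t tT.
  have h2 := is_derive_fun_comp (is_derive_potential P Q r (n t)) (dn t tT).
  apply: is_derive_ex; eexists; split; first by derive_fun.
  by rewrite /= an//; field.
rewrite (_ : 0 = (w * 0) * (w * 0) - potential P Q r 0); last first.
  by rewrite potential0 mulr0 mul0r subr0.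
apply: cvgB; last exact: (cvg_comp n (potential P Q r) lim_n cpot).
have lwa : w * a t 0 i_n @[t --> -oo] --> w * 0 by apply: cvgM => //; exact: cvg_cst.
by apply: cvgM.
Qed.

(** The energy gives [|m| <= sqrt P |sin n| <= sqrt P |n - z|] for [z] equal to [pi] or [- pi].
    Reaching [z] would force [n] to be constantly [z], against its limit [0]; continuity then keeps
    [|n|] below [pi]. *)
Let angle_lt_pi (n m : R -> R) T : 0 < T ->
  (forall t : R, t < T -> is_derive t 1 n (m t)) -> n t @[t --> -oo] --> 0 ->
  (forall t, t < T -> m t ^+ 2 = potential P Q r (n t)) ->
  forall t, t < T -> `|n t| < pi.
Proof.
move=> T0 dn lim_n mn.
have pi0 : (0 : R) < pi := pi_gt0 R.
have cn t : t < T -> {for t, continuous n} by move=> /dn; exact: is_derive_continuous.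
have never z : `|z| = pi -> forall t, t < T -> n t != z.
  move=> zpi t tT; apply/eqP => nt.
  have sz u : `|sin u| <= `|u - z|.
    have -> : sin u = - sin (u - z).
      case: (ger0P z) zpi => _ e; first by rewrite e sinB cospi sinpi; ring.
      by rewrite e sinD cospi sinpi; ring.
    by rewrite normrN sin_le.
  have n_cst : forall t, t < T -> n t - z = 0.
    apply: (@linear_growth_eq0 _ (fun t => n t - z) m (Num.sqrt P) T t) => //.
    - by move=> u uT; apply: (is_derive_eq (is_derive_fun_add (dn u uT) (is_derive_fun_cst (-
      z) u))); rewrite addr0.
    - move=> u uT; apply: le_trans (ler_wpM2l (sqrtr_ge0 _) (sz (n u))).
      rewrite -(@ler_pXn2r _ 2) ?nnegrE ?mulr_ge0 ?sqrtr_ge0//.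
      rewrite exprMn sqr_sqrtr ?(ltW P_gt0)// !real_normK ?num_real// mn//.
      by rewrite /potential gerBl mulr_ge0 ?sqr_ge0.
    - by rewrite nt subrr.
  have : n t @[t --> -oo] --> z.
    apply: (cvg_near_cst z); near=> u.
    have uT : u < T by near: u; exact: Ninfty_lt.
    by apply/eqP; rewrite -subr_eq0 n_cst.
  move=> /(cvg_unique _ lim_n) => z0.
  have ze : z = 0 := esym (z0 (@Rhausdorff R)).
  by move: zpi pi0; rewrite ze normr0 => <-; rewrite ltxx.
move=> t tT; rewrite ltNge; apply/negP => nt.
near (-oo : set_system R) => u.
have ut : u < t by near: u; exact: Ninfty_lt.
have nu_small : `|n u| < pi.
  near: u; move/cvgrPdist_lt : lim_n => /(_ pi pi0).
  by apply: filterS => u; rewrite sub0r normrN.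
have [||v /andP[_ vt] nv] := @intermediate_value _ (fun t => `|n t|) u t pi (ltW ut).
- move=> x /andP[_ xt].
  by apply: (continuous_fun_comp (f := n)); [exact: norm_continuous|exact: cn (le_lt_trans xt
    tT)].
- by left; rewrite (ltW nu_small) nt.
by have := never (n v) nv v (le_lt_trans vt tT); rewrite eqxx.
Unshelve. all: by end_near. Qed.

Lemma unstable_manifold_immersed_line : immersed_line W.
Proof.
have [th [y [dth [dy [v [C U]]]]]] := unstable_paramP P_gt0 Q_ge0 r_ge0 PQr.
pose g s := lift (th s) (y s).
have dg (s : R) : is_derive s 1 g (lift' (th s) (y s) (dth s) (dy s)).
  exact: isd_lift (up_is_derive_th U s) (up_is_derive_y U s).
have dgE : derive1 g = fun s => lift' (th s) (y s) (dth s) (dy s).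
  by apply/funext => s; rewrite derive1E; case: (dg s).
exists g; split.
- by move=> s; case: (dg s).
- rewrite dgE => s.
  have ct1 : {for s, continuous th} := is_derive_continuous (up_is_derive_th U s).
  have ct2 : {for s, continuous dth} by have := up_dth U; apply.
  have ct3 : {for s, continuous dy} by have := up_dy U; apply.
  have hr : {for s, continuous (fun s => r * th s)} by continuity_fun.
  have ct4 := continuous_fun_comp (f := th) (@continuous_sin R (th s)) ct1.
  have ct5 := continuous_fun_comp (f := th) (@continuous_cos R (th s)) ct1.
  have ct6 := continuous_fun_comp (f := fun s => r * th s) (is_derive_continuous
    (is_derive_fun_sinh (is_derive_fun_id (r * th s)))) hr.
  have ct7 := continuous_fun_comp (f := fun s => r * th s) (is_derive_continuous
    (is_derive_fun_cosh (is_derive_fun_id (r * th s)))) hr.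
  apply: cvg_state.
  + by suff : {for s, continuous (fun s => k0 * (- sin (th s) * dth s))} by []; continuity_fun.
  + by suff : {for s, continuous (fun s => k0 * (c2 / w) * (cos (th s) * dth s))} by [];
    continuity_fun.
  + by suff : {for s, continuous (fun s => dy s / w)} by []; continuity_fun.
  + by suff : {for s, continuous (fun s => l0 * (c4 / nu) * (cosh (r * th s) * (r * dth s)))}
    by []; continuity_fun.
  + by suff : {for s, continuous (fun s => l0 * (sinh (r * th s) * (r * dth s)))} by [];
    continuity_fun.
- by move=> s; rewrite dgE lift'_neq0// (up_immersion U).
- move=> s s' e; have [e1 e2] := lift_inj (up_pi U s) (up_pi U s') e.
  exact: (up_inj U).
- apply/seteqP; split => [_ [s _ <-]|x [a [T [T0 sol ax lim]]]].
    exact: lift_subset U s.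
  have [n [m [T1 [T10 dn cm lim_n alift]]]] := subset_lift T0 sol lim.
  pose T2 := Num.min T T1.
  have T20 : 0 < T2 by rewrite lt_min T0.
  have T2T t : t < T2 -> t < T by rewrite lt_min => /andP[].
  have T2T1 t : t < T2 -> t < T1 by rewrite lt_min => /andP[].
  have sol2 : is_solution f [set t | t < T2] a by move=> t /T2T; exact: sol.
  have dn2 (t : R) : t < T2 -> is_derive t 1 n (m t) by move=> /T2T1; exact: dn.
  have al2 t : t < T2 -> a t = lift (n t) (m t) by move=> /T2T1; exact: alift.
  have en := energy T20 sol2 dn2 lim_n lim al2.
  have npi := angle_lt_pi T20 dn2 lim_n en.
  have [s [ths ys]] := up_surj U T20 dn2 (fun t h => cm t (T2T1 t h)) lim_n npi en.
  by exists s => //; rewrite /g ths ys -alift.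
Qed.
End UnstableManifold.

(** * The linearization *)

Lemma det_diag_row (S : comNzRingType) (n : nat) (A : 'M[S]_n.+1) (i : 'I_n.+1) (x : S) :
  (forall j, A i j = x *+ (i == j)) -> \det A = x * \det (row' i (col' i A)).
Proof.
move=> Ai; rewrite (expand_det_row _ i) (bigD1 i)//= big1 => [|j ji].
  by rewrite addr0 Ai eqxx mulr1n /cofactor -signr_odd addnn odd_double expr0 mul1r.
by rewrite Ai eq_sym (negbTE ji) mulr0n mul0r.
Qed.

Lemma det_mx22 (S : comNzRingType) (A : 'M[S]_2) :
  \det A = A 0 0 * A 1 1 - A 0 1 * A 1 0.
Proof.
rewrite (expand_det_row _ 0) !big_ord_recl big_ord0 /cofactor !det_mx11 !mxE.
rewrite /= expr0 expr1 mul1r mulN1r addr0 mulrN.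
by congr (A 0 _ * A _ _ - A 0 _ * A _ _); apply/val_inj.
Qed.

Lemma det_mx33 (S : comNzRingType) (A : 'M[S]_3) : \det A =
  A 0 0 * (A 1 1 * A 2 2 - A 1 2 * A 2 1) - A 0 1 * (A 1 0 * A 2 2 - A 1 2 * A 2 0)
  + A 0 2 * (A 1 0 * A 2 1 - A 1 1 * A 2 0).
Proof.
rewrite (expand_det_row _ 0) !big_ord_recl big_ord0 /cofactor.
have d2 (B : 'M[S]_2) := det_mx22 B.
pose a (i j : nat) := A (inord i) (inord j).
have aE (i j : 'I_3) : A i j = a i j by rewrite /a !inord_val.
rewrite !d2 !mxE !aE /= /bump /= !(add0n, addn0, add1n, addn1).
rewrite !(expr0, expr1, expr2, add0n, addn0, mul1r, mulN1r, addr0).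
ring.
Qed.

Section Hyperbolicity.
Context {R : realType}.
Variables (c1 c2 c3 c4 c5 c6 : R).
Let f := quad_field c1 c2 c3 c4 c5 c6.

Let dfield (p v : 'rV[R]_5) : 'rV[R]_5 :=
  state (c1 * (v 0 i_m * p 0 i_n + p 0 i_m * v 0 i_n))
        (c2 * (v 0 i_n * p 0 i_k + p 0 i_n * v 0 i_k))
        (c3 * (v 0 i_k * p 0 i_m + p 0 i_k * v 0 i_m) +
         c6 * (v 0 i_kt * p 0 i_mt + p 0 i_kt * v 0 i_mt))
        (c4 * (v 0 i_n * p 0 i_kt + p 0 i_n * v 0 i_kt))
        (c5 * (v 0 i_mt * p 0 i_n + p 0 i_mt * v 0 i_n)).

Let isd_line {n : nat} (p v : 'rV[R]_n) i :
  is_derive (0 : R) 1 (fun h : R => (h *: v + p) 0 i) (v 0 i).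
Proof.
rewrite (_ : (fun h : R => (h *: v + p) 0 i) = fun h => h * v 0 i + p 0 i); last first.
  by apply/funext => h; rewrite !mxE.
apply: is_derive_ex; eexists; split; first by derive_fun.
by rewrite /=; ring.
Qed.

Let line0 {n : nat} (p v : 'rV[R]_n) i : ((0 : R) *: v + p) 0 i = p 0 i.
Proof. by rewrite scale0r add0r. Qed.

Let isd_field p v : is_derive p v f (dfield p v).
Proof.
apply: is_derive_lineP.
have h1 := isd_line p v i_k; have h2 := isd_line p v i_m; have h3 := isd_line p v i_n.
have h4 := isd_line p v i_mt; have h5 := isd_line p v i_kt.
apply: is_derive_state; (apply: is_derive_ex; eexists; split; first by derive_fun);
  by rewrite /= !line0; ring.
Qed.

Let differentiable_field p : differentiable f p.
Proof.
have h i : differentiable (fun x : 'rV[R]_5 => x 0 i) p by exact: differentiable_coord_row.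
have hM c i j : differentiable (fun x : 'rV[R]_5 => c * x 0 i * x 0 j) p.
  apply: (@differentiableM _ _ (fun x : 'rV[R]_5 => c * x 0 i) (fun x => x 0 j)) => //.
  by apply: (@differentiableM _ _ (cst c) (fun x : 'rV[R]_5 => x 0 i)) => //; exact:
    differentiable_cst.
apply: differentiable_rowP; apply: forall_coord5.
- by rewrite (_ : (fun x => _) = fun x : 'rV[R]_5 => c1 * x 0 i_m * x 0 i_n)//; apply/funext
  => x; rewrite mxE.
- by rewrite (_ : (fun x => _) = fun x : 'rV[R]_5 => c2 * x 0 i_n * x 0 i_k)//; apply/funext
  => x; rewrite mxE.
- rewrite (_ : (fun x => _) = (fun x : 'rV[R]_5 => c3 * x 0 i_k * x 0 i_m) + (fun x :
  'rV[R]_5 => c6 * x 0 i_kt * x 0 i_mt)).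
    by apply: differentiableD.
  by apply/funext => x; rewrite mxE.
- by rewrite (_ : (fun x => _) = fun x : 'rV[R]_5 => c4 * x 0 i_n * x 0 i_kt)//; apply/funext
  => x; rewrite mxE.
- by rewrite (_ : (fun x => _) = fun x : 'rV[R]_5 => c5 * x 0 i_mt * x 0 i_n)//; apply/funext
  => x; rewrite mxE.
Qed.

Let mul_jacobian p v : v *m jacobian f p = dfield p v.
Proof. by rewrite -deriveEjacobian//; case: (isd_field p v). Qed.

Variables (k0 l0 : R).
Let p0 : 'rV[R]_5 := state k0 0 0 0 l0.
Let D := k0 ^+ 2 * (c2 * c3) + l0 ^+ 2 * (c4 * c6).

(** The Jacobian acts on row vectors from the right: row [i] is the derivative of the field along
    coordinate [i]. *)
Let jacobianE (i j : 'I_5) : jacobian f p0 i j =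
  [:: 0; c2 * k0 * (i == 2 :> nat)%:R; c3 * k0 * (i == 1 :> nat)%:R + c6 * l0 * (i == 3 :>
    nat)%:R;
      c4 * l0 * (i == 2 :> nat)%:R; 0]`_j.
Proof.
have -> : jacobian f p0 i j = ((delta_mx 0 i : 'rV[R]_5) *m jacobian f p0) 0 j.
  by rewrite -rowE [RHS]mxE.
rewrite mul_jacobian; have [E1 E2 E3 E4 E5] := stateE k0 0 0 0 l0.
rewrite /dfield E1 E2 E3 E4 E5 mxE !mxE !eqxx /=.
have e (k : 'I_5) : (k == i) = (i == k :> nat) by rewrite eq_sym.
by rewrite !e; congr nth; congr [:: _; _; _; _; _]; rewrite /=; ring.
Qed.

Let char_poly_jacobian : char_poly (jacobian f p0) = 'X ^+ 3 * ('X ^+ 2 - D%:P).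
Proof.
move: jacobianE; rewrite /char_poly; move: (jacobian f p0) => J JE.
have entry i j : char_poly_mx J i j = 'X *+ (i == j) -
   ([:: 0; c2 * k0 * (i == 2 :> nat)%:R; c3 * k0 * (i == 1 :> nat)%:R + c6 * l0 * (i == 3 :>
     nat)%:R;
      c4 * l0 * (i == 2 :> nat)%:R; 0]`_j)%:P.
  by rewrite !mxE JE.
move: (char_poly_mx J) entry => C entry.
(* Moving [a_kt] or [a_k] alone stays among equilibria, so these two rows of the Jacobian vanish and
   give [X ^ 2]. The block on (a_m, a_n, a_mt) contributes [X (X ^ 2 - D)]. *)
rewrite (@det_diag_row _ _ _ i_kt 'X) => [|j]; last first.
  by rewrite entry; move: j; apply: forall_coord5; rewrite /= ?mulr0 ?addr0 subr0.
rewrite (@det_diag_row _ _ _ 0 'X) => [|j]; last first.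
  rewrite !mxE entry /=; case: j => [[|[|[|[|//]]]] /= _]; rewrite /bump /= ?mulr0 ?addr0
    subr0 //.
have d3 (B : 'M[{poly R}]_3) := det_mx33 B.
rewrite d3 !mxE !entry /= /bump /=.
rewrite !(mulr0, addr0, add0r, mulr1, mulr1n, mulr0n, subr0, sub0r).
by rewrite /D !(polyCD, polyCM, expr2); ring.
Qed.

Hypothesis c3_neq0 : c3 != 0.
Hypothesis saddle : 0 < D.
Hypothesis k0_neq0 : k0 != 0.

(* The equilibria with [a_n = 0] form the cone
   [c3 * a_k * a_m + c6 * a_kt * a_mt = 0], rationally parametrized near [p0]. *)
Let patch (u : 'rV[R]_3) : 'rV[R]_5 :=
  state (k0 + u 0 0) (- (c6 * (l0 + u 0 1) * u 0 2)) 0 (c3 * (k0 + u 0 0) * u 0 2) (l0 + u 0 1).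

Let dpatch (u v : 'rV[R]_3) : 'rV[R]_5 :=
  state (v 0 0) (- (c6 * (v 0 1 * u 0 2 + (l0 + u 0 1) * v 0 2))) 0
    (c3 * (v 0 0 * u 0 2 + (k0 + u 0 0) * v 0 2)) (v 0 1).

Let isd_patch u v : is_derive u v patch (dpatch u v).
Proof.
apply: is_derive_lineP.
have h1 := isd_line u v 0; have h2 := isd_line u v 1; have h3 := isd_line u v 2.
apply: is_derive_state; (apply: is_derive_ex; eexists; split; first by derive_fun);
  by rewrite /= ?line0; ring.
Qed.

Let differentiable_patch u : differentiable patch u.
Proof.
have h i : differentiable (fun x : 'rV[R]_3 => x 0 i) u by exact: differentiable_coord_row.
have hC (c : R) : differentiable (fun x : 'rV[R]_3 => c) u by exact: differentiable_cst.
have hA c i : differentiable (fun x : 'rV[R]_3 => c + x 0 i) u.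
  exact: (@differentiableD _ _ _ (cst c) (fun x : 'rV[R]_3 => x 0 i)).
have hM c d i j : differentiable (fun x : 'rV[R]_3 => c * (d + x 0 i) * x 0 j) u.
  apply: (@differentiableM _ _ (fun x : 'rV[R]_3 => c * (d + x 0 i)) (fun x => x 0 j)) => //.
  exact: (@differentiableM _ _ (cst c) (fun x : 'rV[R]_3 => d + x 0 i)).
apply: differentiable_rowP; apply: forall_coord5.
- by rewrite (_ : (fun x => _) = fun x : 'rV[R]_3 => k0 + x 0 0)//; apply/funext => x;
  rewrite mxE.
- rewrite (_ : (fun x => _) = - (fun x : 'rV[R]_3 => c6 * (l0 + x 0 1) * x 0 2)).
    exact: differentiableN.
  by apply/funext => x; rewrite mxE.
- by rewrite (_ : (fun x => _) = cst 0)//; apply/funext => x; rewrite mxE.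
- by rewrite (_ : (fun x => _) = fun x : 'rV[R]_3 => c3 * (k0 + x 0 0) * x 0 2)//;
  apply/funext => x; rewrite mxE.
- by rewrite (_ : (fun x => _) = fun x : 'rV[R]_3 => l0 + x 0 1)//; apply/funext => x;
  rewrite mxE.
Qed.

Let mul_jacobian_patch u v : v *m jacobian patch u = dpatch u v.
Proof. by rewrite -deriveEjacobian//; case: (isd_patch u v). Qed.

Let continuous_jacobian_patch u : {for u, continuous (jacobian patch)}.
Proof.
have FF : Filter (nbhs u) := nbhs_filter u.
have cc k : (fun x : 'rV[R]_3 => x 0 k) x @[x --> u] --> u 0 k by exact: coord_continuous.
have cD v : dpatch z v @[z --> u] --> dpatch u v.
  have cst (c : R) : cst c x @[x --> u] --> c by exact: cvg_cst.
  have h1 : v 0 1 * x 0 2 + (l0 + x 0 1) * v 0 2 @[x --> u] -->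
            v 0 1 * u 0 2 + (l0 + u 0 1) * v 0 2.
    exact: (cvgD (cvgM (cst (v 0 1)) (cc 2)) (cvgM (cvgD (cst l0) (cc 1)) (cst (v 0 2)))).
  have h2 : v 0 0 * x 0 2 + (k0 + x 0 0) * v 0 2 @[x --> u] -->
            v 0 0 * u 0 2 + (k0 + u 0 0) * v 0 2.
    exact: (cvgD (cvgM (cst (v 0 0)) (cc 2)) (cvgM (cvgD (cst k0) (cc 0)) (cst (v 0 2)))).
  exact: (cvg_state (cst (v 0 0)) (cvgN (cvgM (cst c6) h1)) (cst 0) (cvgM (cst c3) h2) (cst
    (v 0 1))).
have JE z i j : jacobian patch z i j = dpatch z (delta_mx 0 i) 0 j.
  by rewrite -mul_jacobian_patch -rowE [RHS]mxE.
move: (jacobian patch) JE => J JE.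
have H := (@cvg_mxP R 'rV[R]_3 (nbhs u) FF 3 5 J (J u)).2.
apply: H => i j.
rewrite JE (_ : (fun z => _) = fun z => dpatch z (delta_mx 0 i) 0 j); last exact/funext.
have /(@cvg_mxP _ _ (nbhs u) FF) := cD (delta_mx 0 i); apply.
Qed.

(** An imaginary [z] has [z ^ 2 <= 0 < D], so it can only be a root of [X ^ 3]; as [D] is nonzero,
    the multiplicity of [0] is 3, the dimension of the cone. *)
Lemma hyperbolic_quad_field : hyperbolic_equilibrium f 3 p0.
Proof.
have [E1 E2 E3 E4 E5] := stateE k0 0 0 0 l0.
split => //.
- rewrite /f /quad_field E1 E2 E3 E4 E5 !(mulr0, mul0r) addr0.
  by apply: row5P; rewrite !mxE.
- exists patch; split.
  + by rewrite /patch !mxE !(addr0, mulr0) oppr0.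
  + by near=> u; split; [exact: differentiable_patch|exact: continuous_jacobian_patch].
  + apply: inj_row_free => v; rewrite mul_jacobian_patch => e.
    have [F1 F2 F3 F4 F5] := stateE (v 0 0) (- (c6 * (v 0 1 * (0 : 'rV[R]_3) 0 2 + (l0 + (0 :
      'rV[R]_3) 0 1) * v 0 2))) 0
    (c3 * (v 0 0 * (0 : 'rV[R]_3) 0 2 + (k0 + (0 : 'rV[R]_3) 0 0) * v 0 2)) (v 0 1).
    move: F1 F4 F5; rewrite -/(dpatch 0 v) e !mxE => /esym v0 /esym/eqP v2 /esym v1.
    move: v2; rewrite v0 mul0r add0r addr0 !mulf_eq0 (negbTE c3_neq0) (negbTE k0_neq0) /= =>
      /eqP v2.
    apply/rowP => -[[|[|[|//]]] i]; rewrite mxE.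
    * by rewrite -v0; congr (v 0 _); exact/val_inj.
    * by rewrite -v1; congr (v 0 _); exact/val_inj.
    * by rewrite -v2; congr (v 0 _); exact/val_inj.
  + near=> u.
    have [F1 F2 F3 F4 F5] := stateE (k0 + u 0 0) (- (c6 * (l0 + u 0 1) * u 0 2)) 0 (c3 * (k0
      + u 0 0) * u 0 2) (l0 + u 0 1).
    rewrite /f /quad_field /patch F1 F2 F3 F4 F5.
    apply: row5P; rewrite !mxE /= ?(mulr0, mul0r)//; ring.
- move=> z; rewrite eigenvalue_root_char -map_char_poly char_poly_jacobian.
  rewrite rmorphM rmorphB !rmorphXn /= map_polyX map_polyC /= rootM.
  move=> /orP[|].
    by rewrite /root !hornerE expf_eq0 /= => /eqP.
  rewrite /root !hornerE; case: z => x y /= + x0; rewrite x0.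
  rewrite expr2 eq_complex /= => /andP[/eqP h _].
  by exfalso; have := sqr_ge0 y; move: saddle h; rewrite expr2; lra.
- rewrite char_poly_jacobian mupMl.
    by rewrite -['X]subr0 -polyC0 mup_XsubCX eqxx.
  by rewrite /root !hornerE expr0n sub0r oppr_eq0 gt_eqF.
Unshelve. all: by end_near. Qed.
End Hyperbolicity.

(** * Conserved quantities *)

Section Conics.
Context {R : realType}.
Implicit Types (al alt e : R).

Lemma ellipse_level1 al e : al < 1 -> 0 < e -> is_ellipse (level1 al e).
Proof.
move=> al1 e0; have b0 : 0 < 1 - al by rewrite subr_gt0.
exists (Num.sqrt e), (Num.sqrt (e / (1 - al))).
rewrite !sqrtr_gt0 divr_gt0//; split => //; apply/seteqP; split => z /=.
all: rewrite !sqr_sqrtr ?ltW ?divr_gt0// invf_div.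
- move=> h; transitivity ((z.1 ^+ 2 + (1 - al) * z.2 ^+ 2) / e).
    by field; rewrite gt_eqF.
  by rewrite -h divff// gt_eqF.
- by move=> h; rewrite /level1 /= -[LHS]mulr1 -[X in _ * X = _]h; field; rewrite gt_eqF.
Qed.

(** The sign of [e] decides which axis the hyperbola meets, so the semi-axes are built from [|e|]
    and the right-hand side is [Num.sg e]. *)
Lemma hyperbola_level3 alt e : alt < 0 -> e != 0 -> is_hyperbola (level3 alt e).
Proof.
move=> a0 e0; have n0 : 0 < `|e| by rewrite normr_gt0.
have a0' : 0 < - alt by rewrite oppr_gt0.
exists (Num.sqrt `|e|), (Num.sqrt (`|e| / - alt)), (Num.sg e).
rewrite !sqrtr_gt0 divr_gt0//; split => //.
  by move: e0; rewrite neq_lt => /orP[h|h]; [right; rewrite ltr0_sg|left; rewrite gtr0_sg].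
have sgn : e = Num.sg e * `|e| by rewrite mulr_sg_norm.
apply/seteqP; split => z /=; rewrite !sqr_sqrtr ?ltW ?divr_gt0// invf_div => h.
- have -> : Num.sg e = e / `|e| by rewrite [X in _ = X / _]sgn mulfK ?gt_eqF.
  transitivity ((z.1 ^+ 2 + alt * z.2 ^+ 2) / `|e|); last by rewrite -h.
  by field; rewrite gt_eqF.
- by rewrite /level3 /= [LHS]sgn -h; field; rewrite gt_eqF.
Qed.

Lemma hyperboloid_level2 al alt e : al < 0 -> alt < 1 -> e != 0 ->
  is_hyperboloid (level2 al alt e).
Proof.
move=> a0 b0 e0; have n0 : 0 < `|e| by rewrite normr_gt0.
have a0' : 0 < - al by rewrite oppr_gt0.
have b0' : 0 < 1 - alt by rewrite subr_gt0.
exists (Num.sqrt (`|e| / - al)), (Num.sqrt (`|e| / (1 - alt))), (Num.sqrt `|e|), (Num.sg e).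
rewrite !sqrtr_gt0 !divr_gt0//.
have sgn : e = Num.sg e * `|e| by rewrite mulr_sg_norm.
have -> : [set z : R * R * R | z.1.2 ^+ 2 / Num.sqrt (`|e| / (1 - alt)) ^+ 2 +
   z.2 ^+ 2 / Num.sqrt `|e| ^+ 2 - z.1.1 ^+ 2 / Num.sqrt (`|e| / - al) ^+ 2 = Num.sg e] =
   level2 al alt e.
  apply/seteqP; split => z /=; rewrite !sqr_sqrtr ?ltW ?divr_gt0// !invf_div => h.
  - by rewrite /level2 /= [LHS]sgn -h; field; rewrite gt_eqF.
  - have -> : Num.sg e = e / `|e| by rewrite [X in _ = X / _]sgn mulfK ?gt_eqF.
    transitivity ((z.2 ^+ 2 + al * z.1.1 ^+ 2 + (1 - alt) * z.1.2 ^+ 2) / `|e|); last by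
      rewrite -h.
    by field; rewrite gt_eqF.
split => //.
by move: e0; rewrite neq_lt => /orP[h|h]; [right; rewrite ltr0_sg|left; rewrite gtr0_sg].
Qed.

Lemma cst_on_interval (I : set R) (g : R -> R) : is_interval I ->
  (forall t : R, I t -> is_derive t 1 g 0) -> forall s t, I s -> I t -> g s = g t.
Proof.
move=> itvI dg.
have lt s t : I s -> I t -> s < t -> g s = g t.
  move=> Is It st; have [c _] := @mean_value _ g (fun=> 0) s t st
    (fun x xst => dg x (itvI s t Is It x xst)).
  by rewrite mul0r => /eqP; rewrite subr_eq0 => /eqP.
move=> s t Is It; have [h|h|->//] := ltgtP s t; first exact: lt.
by apply/esym/lt.
Qed.
End Conics.

Unset Implicit Arguments.

(** The signs of the equilibria are covered by letting [ak0] and [akt0] be arbitrary reals. If [G]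
    were [0], the squared nonzero eigenvalue would become [l0 ^ 2 c4 c6 <= 0] and the saddle would
    be lost. *)
Theorem theorem4p12 (R : realType) (lk lm ln lmt lkt G Gt : R)
    (hlm : lm < lk) (hlk : lk < ln) (hlmt : lmt < ln) (hln : ln < lkt) :
  let f := resonant_field lk lm ln lmt lkt G Gt in
  let al := alpha lk lm ln in
  let alt := alphat ln lmt lkt in
  [/\ al < 0 /\ alt < 0,
      G != 0 ->
      exists2 c : R, 0 < c &
        forall ak0 akt0 : R, `|akt0| < c * `|ak0| ->
          hyperbolic_equilibrium f 3 (state ak0 0 0 0 akt0) /\
          immersed_line (unstable_manifold f (state ak0 0 0 0 akt0))
    & forall (I : set R) (a : R -> 'rV[R]_5),
        open I -> is_interval I -> is_solution f I a ->
        exists e1 e2 e3 : R,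
          [/\ forall t, I t ->
                [/\ level1 al e1 (a t 0 i_k, a t 0 i_m),
                    level3 alt e3 (a t 0 i_kt, a t 0 i_mt)
                  & level2 al alt e2 (a t 0 i_m, a t 0 i_mt, a t 0 i_n)],
              e1 != 0 -> is_ellipse (level1 al e1),
              e3 != 0 -> is_hyperbola (level3 alt e3)
            & e2 != 0 -> is_hyperboloid (level2 al alt e2)]].
Proof.
move=> f al alt.
have dlm : 0 < lk - lm by rewrite subr_gt0.
have dlk : 0 < ln - lk by rewrite subr_gt0.
have dlmt : 0 < ln - lmt by rewrite subr_gt0.
have dln : 0 < lkt - ln by rewrite subr_gt0.
have dnm : 0 < ln - lm by rewrite subr_gt0 (lt_trans hlm).
have dkm : 0 < lkt - lmt by rewrite subr_gt0 (lt_trans hlmt).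
have al0 : al < 0 by rewrite /al /alpha pmulr_llt0 ?invr_gt0//; lra.
have alt0 : alt < 0 by rewrite /alt /alphat pmulr_llt0 ?invr_gt0//; lra.
split => // [G0|I a _ itvI sol].
- set c1 := (lm - ln) * G; set c2 := (ln - lk) * G; set c3 := (lk - lm) * G.
  set c4 := (ln - lkt) * Gt; set c5 := (lmt - ln) * Gt; set c6 := (lkt - lmt) * Gt.
  have fE : f = quad_field c1 c2 c3 c4 c5 c6 by [].
  have G2 : 0 < G ^+ 2 by rewrite exprn_even_gt0.
  have c12 : c1 * c2 < 0.
    rewrite (_ : c1 * c2 = - ((ln - lm) * (ln - lk) * G ^+ 2)); last by rewrite /c1 /c2; ring.
    by rewrite oppr_lt0; apply: mulr_gt0 G2; exact: mulr_gt0.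
  have c23 : 0 < c2 * c3.
    rewrite (_ : c2 * c3 = (ln - lk) * (lk - lm) * G ^+ 2); last by rewrite /c3 /c2; ring.
    by apply: mulr_gt0 G2; exact: mulr_gt0.
  have c45 : 0 <= c4 * c5.
    rewrite (_ : c4 * c5 = (lkt - ln) * (ln - lmt) * Gt ^+ 2); last by rewrite /c4 /c5; ring.
    by rewrite mulr_ge0 ?sqr_ge0// ltW// mulr_gt0.
  have c46 : c4 * c6 <= 0.
    rewrite (_ : c4 * c6 = - ((lkt - ln) * (lkt - lmt) * Gt ^+ 2)); last by rewrite /c4 /c6; ring.
    by rewrite oppr_le0 mulr_ge0 ?sqr_ge0// ltW// mulr_gt0.
  have c456 : c4 * c5 = 0 -> [/\ c4 = 0, c5 = 0 & c6 = 0].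
    move/eqP; rewrite !mulf_eq0.
    have /negbTE -> : ln - lkt != 0 by rewrite lt_eqF//; lra.
    have /negbTE -> : lmt - ln != 0 by rewrite lt_eqF//; lra.
    by rewrite /= orbb => /eqP Gt0; rewrite /c4 /c5 /c6 Gt0 !mulr0.
  (* The saddle condition is [l0 ^ 2 (- c4 c6) < k0 ^ 2 c2 c3]. The added [1] keeps the quotient
     meaningful when [Gt = 0], and only strengthens the requirement on [l0]. *)
  have den : 0 < 1 - c4 * c6 by lra.
  have c_gt0 : 0 < Num.sqrt (c2 * c3 / (1 - c4 * c6)) by rewrite sqrtr_gt0 divr_gt0.
  exists (Num.sqrt (c2 * c3 / (1 - c4 * c6))) => // k0 l0 l0k0.
  have k00 : k0 != 0.
    by apply: contraTneq l0k0 => ->; rewrite normr0 mulr0 -leNgt normr_ge0.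
  have saddle : 0 < k0 ^+ 2 * (c2 * c3) + l0 ^+ 2 * (c4 * c6).
    have : l0 ^+ 2 < c2 * c3 / (1 - c4 * c6) * k0 ^+ 2.
      rewrite -(real_normK (num_real l0)) -(real_normK (num_real k0)).
      rewrite -[c2 * c3 / _]sqr_sqrtr; last by rewrite ltW// divr_gt0.
      by rewrite -exprMn ltr_pXn2r ?nnegrE ?mulr_ge0// ltW.
    rewrite mulrAC ltr_pdivlMr// => h.
    by have := sqr_ge0 l0; lra.
  have c30 : c3 != 0 by apply: contraTneq c23 => ->; rewrite mulr0 ltxx.
  split; first exact: hyperbolic_quad_field.
  exact: unstable_manifold_immersed_line.
- pose E1 t := a t 0 i_k ^+ 2 + (1 - al) * a t 0 i_m ^+ 2.
  pose E2 t := a t 0 i_n ^+ 2 + al * a t 0 i_m ^+ 2 + (1 - alt) * a t 0 i_mt ^+ 2.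
  pose E3 t := a t 0 i_kt ^+ 2 + alt * a t 0 i_mt ^+ 2.
  have alt1 : alt < 1 by lra.
  have al1 : al < 1 by lra.
  (* On an empty interval the constants [0] do, every conic claim being conditional on a nonzero
     level. *)
  have [[t0 It0]|noI] := pselect (exists t, I t); last first.
    exists 0, 0, 0; rewrite eqxx; split => // t It; case: noI; by exists t.
  have coord (t : R) i : I t -> is_derive t 1 (fun t => a t 0 i) (f (a t) 0 i).
    by move=> /sol /is_derive_mxP; apply.
  have nk : ln - lk != 0 by rewrite gt_eqF.
  have nkt : lkt - ln != 0 by rewrite gt_eqF.
  (* [al] and [alt] are the ratios for which the cubic terms a_k a_m a_n and a_kt a_mt a_n cancel in
     the three derivatives. *)
  have dE1 (t : R) : I t -> is_derive t 1 E1 0.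
    move=> It; have h1 := coord t i_k It; have h2 := coord t i_m It.
    apply: is_derive_ex; eexists; split; first by rewrite /E1; derive_fun.
    by rewrite /= !mxE /al /alpha /=; field.
  have dE2 (t : R) : I t -> is_derive t 1 E2 0.
    move=> It; have h1 := coord t i_n It; have h2 := coord t i_m It.
    have h3 := coord t i_mt It.
    apply: is_derive_ex; eexists; split; first by rewrite /E2; derive_fun.
    by rewrite /= !mxE /al /alpha /alt /alphat /=; field; rewrite nk nkt.
  have dE3 (t : R) : I t -> is_derive t 1 E3 0.
    move=> It; have h1 := coord t i_kt It; have h2 := coord t i_mt It.
    apply: is_derive_ex; eexists; split; first by rewrite /E3; derive_fun.
    by rewrite /= !mxE /alt /alphat /=; field.
  exists (E1 t0), (E2 t0), (E3 t0); split.
  + move=> t It; split.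
    * exact: cst_on_interval itvI dE1 t0 t It0 It.
    * exact: cst_on_interval itvI dE3 t0 t It0 It.
    * exact: cst_on_interval itvI dE2 t0 t It0 It.
  + move=> E10; apply: ellipse_level1 => //.
    rewrite lt_neqAle eq_sym E10 /= addr_ge0 ?sqr_ge0// mulr_ge0 ?sqr_ge0//; lra.
  + exact: hyperbola_level3.
  + exact: hyperboloid_level2.
Qed.
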